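(* Let $N\ge2$. For every prime $\ell\nmid 2N$, we have $T_\ell\Theta_N=(\ell+\sigma_\ell)\Theta_N$ in $H^1(\tilde\Gamma_0(N),K_2(\mathbb{Q}(\mu_N))/Z_N)$. If $N$ is odd, then $2(T_2-2-\sigma_2)\Theta_N=0$ in this cohomology group.
   Context: $\zeta_N$ a primitive $N$th root of unity; $\sigma_j\in\mathrm{Gal}(\mathbb{Q}(\mu_N)/\mathbb{Q})$ with $\sigma_j(\zeta_N)=\zeta_N^j$; $Z_N=\langle\{-1,-\zeta_N\}\rangle\subset K_2(\mathbb{Q}(\mu_N))$. $\tilde\Gamma_0(N)=\{\begin{pmatrix}a&b\\c&d\end{pmatrix}\in\mathrm{GL}_2(\mathbb{Z}):N\mid c\}$ and $\Delta_0(N)$ is the monoid of integer matrices $\begin{pmatrix}a&b\\c&d\end{pmatrix}$ of nonzero determinant with $N\mid c$, $\gcd(d,N)=1$; it acts on $M=K_2(\mathbb{Q}(\mu_N))/Z_N$ by $\begin{pmatrix}a&b\\c&d\end{pmatrix}\mapsto\sigma_{d\bmod N}$. $\Theta_N$ is the $1$-cocycle $\tilde\Gamma_0(N)\to M$, $\Theta_{N,\gamma}=\sum_{i=1}^k\{1-\zeta_N^{d_i},1-\zeta_N^{-d_{i-1}}\}$, where $(b_i,d_i)_{i=0}^k$ is any sequence in $\mathbb{Z}^2$ with $(b_0,d_0)=(0,1)$, $(b_k,d_k)=\det(\gamma)(b,d)$, $b_{i-1}d_i-b_id_{i-1}=1$ and $N\nmid d_i$ for $i<k$ (the value is independent of the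 choice). Hecke operator $T_\ell$ for $\ell\nmid N$: with $g_j=\begin{pmatrix}\ell&j\\0&1\end{pmatrix}$ ($0\le j<\ell$), $g_\ell=\begin{pmatrix}1&0\\0&\ell\end{pmatrix}$, and $\gamma g_j=g_{\sigma(j)}\gamma_j$ with $\gamma_j\in\tilde\Gamma_0(N)$ and $\sigma$ a permutation, $(T_\ell\theta)(\gamma)=\sum_j g_{\sigma(j)}\cdot\theta(\gamma_j)$; this induces a well-defined action on $H^1$. *)

(* Defs.v *)
From HB Require Import structures.
From mathcomp Require Import all_boot all_order all_algebra all_field.
From mathcomp Require Import perm.
Set Implicit Arguments. Unset Strict Implicit. Unset Printing Implicit Defensive.
Import GRing.Theory Num.Theory.
Local Open Scope ring_scope.

(* Formal Z-linear combinations of symbols {a,b} over a field L, and the   *)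
(* group  M = K_2(L) / Z_N  given by the Milnor/Matsumoto presentation:    *)
(* K_2(L) = free abelian group on symbols {a,b} (a,b in L^x) modulo        *)
(* bilinearity in each variable and the Steinberg relation {a,1-a} = 0,   *)
(* and Z_N = <{-1,-z}>.  Two formal sums are equal in M iff their          *)
(* difference is an integer combination of relators.                      *)
Section Symbols.
Variable L : fieldType.

Definition fsum := seq (int * (L * L)).

Definition fcoef (s : fsum) (p : L * L) : int := \sum_(t <- s | t.2 == p) t.1.

Definition fscale (c : int) (s : fsum) : fsum := [seq (c * t.1, t.2) | t <- s].

Definition fmap (f : L -> L) (s : fsum) : fsum :=
  [seq (t.1, (f t.2.1, f t.2.2)) | t <- s].

Definition sym (a b : L) : fsum := [:: (1, (a, b))].

Definition is_relator (z : L) (r : fsum) : Prop :=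
  (exists a1 a2 b : L, [/\ a1 != 0, a2 != 0, b != 0 &
     r = [:: (1, (a1 * a2, b)); (-1, (a1, b)); (-1, (a2, b))]])
  \/ (exists a b1 b2 : L, [/\ a != 0, b1 != 0, b2 != 0 &
     r = [:: (1, (a, b1 * b2)); (-1, (a, b1)); (-1, (a, b2))]])
  \/ (exists a : L, [/\ a != 0, a != 1 & r = sym a (1 - a)])
  \/ r = sym (-1) (- z).

Definition Mzero (z : L) (s : fsum) : Prop :=
  exists rs : seq (int * fsum),
    (forall r, r \in rs -> is_relator z r.2) /\
    forall p, fcoef s p = \sum_(r <- rs) r.1 * fcoef r.2 p.

Definition Meq (z : L) (s t : fsum) : Prop := Mzero z (s ++ fscale (-1) t).

End Symbols.

Definition mA (g : 'M[int]_2) : int := g ord0 ord0.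
Definition mB (g : 'M[int]_2) : int := g ord0 ord_max.
Definition mC (g : 'M[int]_2) : int := g ord_max ord0.
Definition mD (g : 'M[int]_2) : int := g ord_max ord_max.

Definition mk2 (a b c d : int) : 'M[int]_2 :=
  \matrix_(i < 2, k < 2)
    if val i == 0%N then (if val k == 0%N then a else b)
    else (if val k == 0%N then c else d).

Definition in_G0t (N : nat) (g : 'M[int]_2) : Prop :=
  (N%:Z %| mC g)%Z /\ (\det g = 1 \/ \det g = -1).

Definition gmat (l : nat) (j : 'I_l.+1) : 'M[int]_2 :=
  if (val j < l)%N then mk2 l%:Z (val j)%:Z 0 1 else mk2 1 0 0 l%:Z.
Arguments gmat : clear implicits.

Definition gact (L : fieldType) (N : nat) (sigma : nat -> {rmorphism L -> L})
  (g : 'M[int]_2) (s : fsum L) : fsum L :=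
  fmap (sigma (absz (mD g %% N%:Z)%Z)) s.

(* s = [:: (b_0,d_0); ...; (b_k,d_k)] is an admissible sequence for g *)
Definition theta_seq_ok (N : nat) (g : 'M[int]_2) (s : seq (int * int)) : Prop :=
  [/\ (0 < size s)%N,
      nth (0, 0) s 0 = (0, 1),
      last (0, 1) s = (\det g * mB g, \det g * mD g),
      (forall i, (i.+1 < size s)%N ->
         (nth (0, 0) s i).1 * (nth (0, 0) s i.+1).2
         - (nth (0, 0) s i.+1).1 * (nth (0, 0) s i).2 = 1) &
      (forall i, (i.+1 < size s)%N -> ~~ (N%:Z %| (nth (0, 0) s i).2)%Z)].

Definition theta_sum (L : fieldType) (z : L) (s : seq (int * int)) : fsum L :=
  [seq (1, (1 - z ^ (nth (0, 0) s i).2, 1 - z ^ (- (nth (0, 0) s i.-1).2)))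
   | i <- iota 1 (size s).-1].

Definition is_Theta (L : fieldType) (N : nat) (z : L)
  (theta : 'M[int]_2 -> fsum L) : Prop :=
  forall g, in_G0t N g ->
    exists s, theta_seq_ok N g s /\ theta g = theta_sum z s.

(* c * T_l theta = c * (l + sigma_l) theta  in H^1(tilde Gamma_0(N), M):
   the difference is the coboundary gamma |-> gamma.m - m of some m *)
Definition hecke_rel (L : fieldType) (N : nat) (z : L)
  (sigma : nat -> {rmorphism L -> L}) (theta : 'M[int]_2 -> fsum L)
  (l : nat) (c : int) : Prop :=
  exists m : fsum L, forall g, in_G0t N g ->
    forall (pi : {perm 'I_l.+1}) (gam : 'I_l.+1 -> 'M[int]_2),
      (forall j, g *m gmat l j = gmat l (pi j) *m gam j /\ in_G0t N (gam j)) ->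
      Meq z
        (fscale c (flatten [seq gact N sigma (gmat l (pi j)) (theta (gam j))
                           | j <- enum 'I_l.+1]))
        (fscale c (fscale l%:Z (theta g) ++ fmap (sigma l) (theta g))
           ++ gact N sigma g m ++ fscale (-1) m).

(* Main.v *)
Require Import Defs.
From HB Require Import structures.
From mathcomp Require Import all_boot all_order all_algebra all_field.
From mathcomp Require Import perm boolp generic_quotient.
From mathcomp Require Import zify ring.
Set Implicit Arguments. Unset Strict Implicit. Unset Printing Implicit Defensive.
Import Order.TTheory GRing.Theory Num.Theory.
Local Open Scope ring_scope.

(* A vector (b, d) of Z^2 stands for the function 1 - z1^b z2^d on G_m^2, specialized at
   z1 = 1, z2 = zeta_N, so that an oriented basis (u, v) of Z^2 gives a symbol f(u, v) in
   K_2(L)/Z_N.  By the Steinberg relation these symbols satisfy f(u, v) = f(u, u+v) + f(u+v, v),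
   hence they are the differences F(v) - F(u) of a potential F on primitive vectors, and Theta_N
   takes gamma to F(det(gamma) gamma e) with e = (0, 1).

   Summing potentials over the l + 1 sublattices of index l gives a function H with
   T_l Theta = H(det(gamma) gamma e) - gamma H(e), and the theorem reduces to the identity
   H(v) - H(u) = l f(u, v) + sigma_l f(u, v) for an oriented basis (u, v).  Replace z^u by an
   indeterminate t: both sides lift to K_2(L(t)), where each sublattice contributes a sum over a
   path in the cone spanned by u and v, along which all tame symbols telescope; what is left at
   the end points cancels because prod_(i < l) (1 - y tau^i) = 1 - y^l for tau of order l.  By
   Milnor's theorem the difference is constant, and it is computed at t = 0, where it equals
   (l - 1) ({1 - y^l, -1} - {1 - y, -1}).  This vanishes for odd l and is killed by 2 for l = 2. *)

(** * Abelian group identities, Steinberg symbols and the group K_2(L)/Z_N *)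

(** Paths between vectors occurring in Theta_N may pass through vectors (b, d) with N | d, where 1 -
    zeta_N^d = 0 has no symbol. [edge_val] gives such edges values forced by the three-term
    relation, so that the potential exists on all primitive vectors. Comparing these values with
    honest symbols leaves errors that are differences of one function ([pole]) at the two ends of an
    edge, and this function vanishes at the end points that matter. Matrices of determinant -1
    reverse oriented bases and cause an error of the same shape.

    Dividing by Z_N makes the potential single valued: once around u, v, -u, -v gives {-z^a, -z^b},
    which is zero only after {-1, -z} is killed.

    Neither L(t) nor its K_2 is constructed. Elements are formal sums of pairs of polynomials,
    tested by all [steinberg] functions on L[t]; tame symbols and specializations are such
    functions. The point t = 0 is used for the comparison because every monomial with a positive
    power of t becomes trivial there. *)

Inductive zexpr :=
  ZZero | ZVar of nat | ZAdd of zexpr & zexpr | ZOpp of zexpr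
| ZMul of zexpr & nat.

Fixpoint zeval (B : zmodType) (env : seq B) (e : zexpr) : B :=
  match e with
  | ZZero => 0
  | ZVar i => nth 0 env i
  | ZAdd e1 e2 => zeval env e1 + zeval env e2
  | ZOpp e1 => - zeval env e1
  | ZMul e1 n => zeval env e1 *+ n
  end.

Fixpoint zcoef (e : zexpr) (i : nat) : int :=
  match e with
  | ZZero => 0
  | ZVar j => (i == j)%:Z
  | ZAdd e1 e2 => zcoef e1 i + zcoef e2 i
  | ZOpp e1 => - zcoef e1 i
  | ZMul e1 n => zcoef e1 i *+ n
  end.

Lemma zevalE (B : zmodType) (env : seq B) e :
  zeval env e = \sum_(i < size env) env`_i *~ zcoef e i.
Proof.
elim: e => [|j|e1 IH1 e2 IH2|e1 IH1|e1 IH1 n] /=; rewrite ?IH1 ?IH2.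
- by rewrite big1.
- have [lej|ltj] := leqP (size env) j.
    rewrite nth_default // big1 // => i _.
    by rewrite (_ : (_ == _) = false) // ltn_eqF // (leq_trans (ltn_ord i)).
  rewrite (bigD1 (Ordinal ltj)) //= eqxx mulr1z big1 ?addr0 // => i ne.
  by rewrite (_ : (_ == _) = false) //; apply: contraNF ne => /eqP ij; apply/eqP/val_inj.
- by rewrite -big_split; apply: eq_bigr => i _; rewrite mulrzDr.
- by rewrite -sumrN; apply: eq_bigr => i _; rewrite mulrNz.
- by rewrite -sumrMnl; apply: eq_bigr => i _; rewrite -mulr_natr natz mulrzA -pmulrn.
Qed.

(** Justifies [zmodule]: an identity valid in the free abelian group on the atoms is decided by
    comparing integer coefficients, which [vm_compute] evaluates. *)
Lemma zeval_eq (B : zmodType) (env : seq B) e1 e2 :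
  all (fun i => zcoef e1 i == zcoef e2 i) (iota 0 (size env)) ->
  zeval env e1 = zeval env e2.
Proof.
move=> /allP eqc; rewrite !zevalE; apply: eq_bigr => i _.
by rewrite (eqP (eqc _ _)) // mem_iota ltn_ord.
Qed.

(* Atoms are compared up to unification, since one element may occur under several instance paths. *)
Ltac zsame x y := match constr:(Set) with
  | _ => let _ := match constr:(Set) with _ => unify x y end in constr:(true)
  | _ => constr:(false)
  end.
Ltac zindex x env :=
  match env with
  | ?y :: ?env' =>
    match zsame x y with
    | true => constr:(0%N)
    | false => let n := zindex x env' in constr:(S n)
    end
  end.
Ltac zmember x env :=
  match env with
  | nil => constr:(false)
  | ?y :: ?env' =>
    match zsame x y with true => constr:(true) | false => zmember x env' end
  end.
Ltac zatoms t env :=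
  match t with
  | GRing.zero => env
  | (?a + ?b)%R => let env1 := zatoms a env in zatoms b env1
  | (- ?a)%R => zatoms a env
  | (?a *+ S ?n)%R => zatoms a env
  | (?a *+ O)%R => zatoms a env
  | _ => match zmember t env with true => env | false => constr:(t :: env) end
  end.
Ltac zreify t env :=
  match t with
  | GRing.zero => constr:(ZZero)
  | (?a + ?b)%R => let x := zreify a env in let y := zreify b env in constr:(ZAdd x y)
  | (- ?a)%R => let x := zreify a env in constr:(ZOpp x)
  | (?a *+ S ?n)%R => let x := zreify a env in constr:(ZMul x (S n))
  | (?a *+ O)%R => let x := zreify a env in constr:(ZMul x O)
  | _ => let n := zindex t env in constr:(ZVar n)
  end.
Ltac zmodule :=
  match goal with
  | |- @eq ?T ?a ?b =>
    let env0 := zatoms a (@nil T) in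
    let env := zatoms b env0 in
    let ea := zreify a env in
    let eb := zreify b env in
    refine (@zeval_eq _ env ea eb _); vm_compute; reflexivity
  end.


Definition feval (T : Type) (B : zmodType) (c : T -> T -> B)
    (s : seq (int * (T * T))) : B :=
  \sum_(t <- s) c t.2.1 t.2.2 *~ t.1.

Section Feval.
Variables (T : Type) (B : zmodType) (c : T -> T -> B).
Implicit Types s t : seq (int * (T * T)).

Lemma feval_nil : feval c [::] = 0. Proof. exact: big_nil. Qed.
Lemma feval_cons x s : feval c (x :: s) = c x.2.1 x.2.2 *~ x.1 + feval c s.
Proof. exact: big_cons. Qed.
Lemma feval_cat s t : feval c (s ++ t) = feval c s + feval c t.
Proof. exact: big_cat. Qed.
Lemma feval_flatten I (r : seq I) (F : I -> seq (int * (T * T))) :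
  feval c (flatten [seq F i | i <- r]) = \sum_(i <- r) feval c (F i).
Proof.
elim: r => [|i r IH]; first by rewrite feval_nil big_nil.
by rewrite /= feval_cat IH big_cons.
Qed.
End Feval.

(* On fractions a = f / (f + g) and 1 - a = g / (f + g), the last clause is {a, 1 - a} = 0;
   stated for f and g it makes sense without passing to the fraction field of R. *)
Record steinberg (R : idomainType) (B : zmodType) (S : R -> R -> B) : Prop :=
  Steinberg {
  stMl : forall a b c, a != 0 -> b != 0 -> c != 0 -> S (a * b) c = S a c + S b c;
  stMr : forall a b c, a != 0 -> b != 0 -> c != 0 -> S a (b * c) = S a b + S a c;
  stD : forall f g, f != 0 -> g != 0 -> f + g != 0 ->
    S f g - S f (f + g) - S (f + g) g + S (f + g) (f + g) = 0 }.

Section Symbol.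
Variables (R : idomainType) (B : zmodType) (S : R -> R -> B).
Hypothesis SP : steinberg S.

Lemma st1l a : a != 0 -> S 1 a = 0.
Proof.
move=> a0; have := stMl SP (oner_neq0 R) (oner_neq0 R) a0.
by rewrite mulr1 -{1}[S 1 a]addr0 => /addrI /esym.
Qed.
Lemma st1r a : a != 0 -> S a 1 = 0.
Proof.
move=> a0; have := stMr SP a0 (oner_neq0 R) (oner_neq0 R).
by rewrite mulr1 -{1}[S a 1]addr0 => /addrI /esym.
Qed.
Lemma st_sub1 a : a != 0 -> 1 - a != 0 -> S a (1 - a) = 0.
Proof.
move=> a0 b0; have := stD SP a0 b0.
by rewrite addrC subrK oner_neq0 st1l // !st1r ?oner_neq0 // !subr0 addr0; apply.
Qed.
Lemma stN1sq a : a != 0 -> S a (-1) *+ 2 = 0.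
Proof.
move=> a0; rewrite mulr2n -(stMr SP) ?oppr_eq0 ?oner_neq0 // mulrNN mulr1.
exact: st1r.
Qed.
Lemma st_diag a : a != 0 -> S a a = S a (-1).
Proof.
move=> a0; have [->|a1] := eqVneq a 1; first by rewrite !st1l ?oppr_eq0 ?oner_neq0.
have n1 : -1 != 0 :> R by rewrite oppr_eq0 oner_neq0.
have b0 : 1 - a != 0 by rewrite subr_eq0 eq_sym.
have c0 : a - 1 != 0 by rewrite subr_eq0.
have := stD SP (oner_neq0 R) c0; rewrite addrC subrK => /(_ a0).
rewrite !st1l // subrr sub0r addrC => /eqP; rewrite subr_eq0 => /eqP ->.
have -> : a - 1 = -1 * (1 - a) by rewrite mulN1r opprB.
by rewrite (stMr SP) // st_sub1 // addr0.
Qed.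
Lemma stN a : a != 0 -> S a (- a) = 0.
Proof.
move=> a0; rewrite -mulN1r (stMr SP) ?oppr_eq0 ?oner_neq0 // st_diag //.
by rewrite -mulr2n stN1sq.
Qed.
Lemma st_anti a b : a != 0 -> b != 0 -> S a b = - S b a.
Proof.
move=> a0 b0; have ab0 : a * b != 0 by rewrite mulf_neq0.
have n1 : -1 != 0 :> R by rewrite oppr_eq0 oner_neq0.
have := st_diag ab0; rewrite !(stMl SP) // !(stMr SP) // !st_diag // => E.
by apply/eqP; rewrite -addr_eq0; apply/eqP;
   apply: (@addrI _ (S a (-1) + S b (-1))); rewrite addr0 -[RHS]E; zmodule.
Qed.
Lemma stXr a b n : a != 0 -> b != 0 -> S a (b ^+ n) = S a b *+ n.
Proof.
move=> a0 b0; elim: n => [|n IH]; first by rewrite st1r.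
by rewrite exprS (stMr SP) ?expf_neq0 // IH mulrS.
Qed.
End Symbol.

Section FieldSymbol.
Variables (L : fieldType) (B : zmodType) (S : L -> L -> B).
Hypothesis Sl : forall a b c, a != 0 -> b != 0 -> c != 0 -> S (a * b) c = S a c + S b c.
Hypothesis Sr : forall a b c, a != 0 -> b != 0 -> c != 0 -> S a (b * c) = S a b + S a c.

Lemma steinberg_field :
  (forall a, a != 0 -> a != 1 -> S a (1 - a) = 0) -> steinberg S.
Proof.
move=> S1; split=> // f g f0 g0 h0; set h := f + g in h0 *.
pose a := f / h; have a0 : a != 0 by rewrite mulf_neq0 ?invr_eq0.
have Ef : f = a * h by rewrite divfK.
have Eb : 1 - a = g / h.
  by rewrite /a -[1](divff h0) -mulrBl /h addrAC subrr add0r.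
have b0 : 1 - a != 0 by rewrite Eb mulf_neq0 ?invr_eq0.
have Eg : g = (1 - a) * h by rewrite Eb divfK.
have a1 : a != 1 by rewrite -subr_eq0 -opprB oppr_eq0.
have E := S1 a a0 a1; clearbody a h; rewrite Ef Eg.
rewrite !(Sl _ _, Sr _ _) ?mulf_neq0 // E; zmodule.
Qed.
End FieldSymbol.

(** * The group K_2(L)/Z_N and its universal property *)

Section K2.
Local Open Scope quotient_scope.
Variables (L : fieldType) (z : L).
Implicit Types s : fsum L.

Lemma fcoef_cat s (t : fsum L) p : fcoef (s ++ t) p = fcoef s p + fcoef t p.
Proof. exact: big_cat. Qed.
Lemma fcoef_scale c s p : fcoef (fscale c s) p = c * fcoef s p.
Proof. by rewrite /fcoef /fscale big_map /= mulr_sumr. Qed.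

Lemma Mzero_ext s (t : fsum L) : (forall p, fcoef s p = fcoef t p) -> Mzero z s -> Mzero z t.
Proof. by move=> E [rs [? H]]; exists rs; split=> // p; rewrite -E. Qed.
Lemma Mzero_nil s : (forall p, fcoef s p = 0) -> Mzero z s.
Proof. by move=> H; exists [::]; split=> // p; rewrite H big_nil. Qed.
Lemma Mzero_cat s (t : fsum L) : Mzero z s -> Mzero z t -> Mzero z (s ++ t).
Proof.
move=> [rs [R1 H1]] [ts [R2 H2]]; exists (rs ++ ts); split.
  by move=> r; rewrite mem_cat => /orP[/R1|/R2].
by move=> p; rewrite big_cat -H1 -H2 fcoef_cat.
Qed.
Lemma Mzero_scale c s : Mzero z s -> Mzero z (fscale c s).
Proof.
move=> [rs [R1 H1]]; exists [seq (c * r.1, r.2) | r <- rs]; split.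
  by move=> r /mapP[r' /R1 ? ->].
move=> p; rewrite fcoef_scale H1 big_map mulr_sumr.
by apply: eq_bigr => r _; rewrite mulrA.
Qed.
Lemma Mzero_relator r : is_relator z r -> Mzero z r.
Proof.
move=> Hr; exists [:: (1, r)]; split; first by move=> x; rewrite inE => /eqP ->.
by move=> p; rewrite big_seq1 mul1r.
Qed.

Definition Meqb s (t : fsum L) := `[< Meq z s t >].
Lemma Meqb_equiv : equiv_class_of Meqb.
Proof.
split.
- move=> s; apply/asboolP/Mzero_nil => p.
  by rewrite fcoef_cat fcoef_scale mulN1r subrr.
- have sy s t : Meq z s t -> Meq z t s.
    move=> /(Mzero_scale (-1)); apply: Mzero_ext => p.
    by rewrite !(fcoef_scale, fcoef_cat); ring.
  by move=> s t; apply/asboolP/asboolP; apply: sy.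
- move=> t s u /asboolP H1 /asboolP H2; apply/asboolP.
  move: (Mzero_cat H1 H2); apply: Mzero_ext => p.
  by rewrite !(fcoef_scale, fcoef_cat); ring.
Qed.
Canonical Meqb_equivRel := EquivRelPack Meqb_equiv.
Definition K2Z := {eq_quot Meqb_equivRel}.
HB.instance Definition _ := Choice.on K2Z.

Definition cls s : K2Z := \pi_K2Z s.
Lemma clsP s t : reflect (Meq z s t) (cls s == cls t).
Proof. by apply: (iffP eqP) => [/eqmodP /asboolP|H] //; apply/eqmodP/asboolP. Qed.
Lemma cls_repr (x : K2Z) : cls (repr x) = x. Proof. exact: reprK. Qed.
Lemma Meq_repr s : Meq z (repr (cls s)) s. Proof. by apply/clsP; rewrite cls_repr. Qed.

Definition kadd (x y : K2Z) := cls (repr x ++ repr y).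
Definition kopp (x : K2Z) := cls (fscale (-1) (repr x)).
Lemma kadd_cls s t : kadd (cls s) (cls t) = cls (s ++ t).
Proof.
apply/eqP/clsP; move: (Mzero_cat (Meq_repr s) (Meq_repr t)).
by apply: Mzero_ext => p; rewrite !(fcoef_scale, fcoef_cat); ring.
Qed.
Lemma kopp_cls s : kopp (cls s) = cls (fscale (-1) s).
Proof.
apply/eqP/clsP; move: (Mzero_scale (-1) (Meq_repr s)).
by apply: Mzero_ext => p; rewrite !(fcoef_scale, fcoef_cat); ring.
Qed.
Lemma cls_ext s t : (forall p, fcoef s p = fcoef t p) -> cls s = cls t.
Proof.
move=> E; apply/eqP/clsP/Mzero_nil => p.
by rewrite fcoef_cat fcoef_scale E mulN1r subrr.
Qed.
Lemma kaddA : associative kadd.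
Proof.
move=> x y t; rewrite -[x]cls_repr -[y]cls_repr -[t]cls_repr !kadd_cls.
by rewrite catA.
Qed.
Lemma kaddC : commutative kadd.
Proof.
move=> x y; rewrite -[x]cls_repr -[y]cls_repr !kadd_cls.
by apply: cls_ext => p; rewrite !fcoef_cat addrC.
Qed.
Lemma kadd0 : left_id (cls [::]) kadd.
Proof. by move=> x; rewrite -[x]cls_repr kadd_cls. Qed.
Lemma kaddN : left_inverse (cls [::]) kopp kadd.
Proof.
move=> x; rewrite -[x]cls_repr kopp_cls kadd_cls; apply: cls_ext => p.
by rewrite fcoef_cat fcoef_scale mulN1r addNr /fcoef big_nil.
Qed.
HB.instance Definition _ := GRing.isZmodule.Build K2Z kaddA kaddC kadd0 kaddN.

Lemma cls_cat s t : cls (s ++ t) = cls s + cls t.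
Proof. by rewrite -kadd_cls. Qed.
Lemma cls_nil : cls [::] = 0. Proof. by []. Qed.
Lemma cls_opp s : cls (fscale (-1) s) = - cls s.
Proof. by rewrite -kopp_cls. Qed.
Lemma cls_scale c s : cls (fscale c s) = cls s *~ c.
Proof.
have P n : cls (fscale n%:Z s) = cls s *+ n.
  elim: n => [|n IH].
    by rewrite mulr0n -cls_nil; apply: cls_ext => p; rewrite fcoef_scale mul0r /fcoef big_nil.
  rewrite mulrS -IH -cls_cat; apply: cls_ext => p.
  by rewrite fcoef_cat !fcoef_scale -addn1 PoszD; ring.
case: c => n; first exact: P.
rewrite NegzE mulrNz -pmulrn -P -cls_opp; apply: cls_ext => p.
by rewrite !fcoef_scale; ring.
Qed.

Definition sy (a b : L) : K2Z := cls (sym a b).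
Lemma cls_feval s : cls s = feval sy s.
Proof.
elim: s => [|[n [a b]] s IH]; first by rewrite feval_nil.
rewrite feval_cons /= -IH /sy -cls_scale -cls_cat.
by congr cls; rewrite /fscale /= mulr1.
Qed.

Lemma cls_relator r : is_relator z r -> cls r = 0.
Proof.
move=> /Mzero_relator Hr; rewrite -cls_nil; apply/eqP/clsP.
by move: Hr; apply: Mzero_ext => p; rewrite fcoef_cat fcoef_scale /fcoef big_nil mulr0 addr0.
Qed.
Lemma sy_steinberg : steinberg sy.
Proof.
apply: steinberg_field.
- move=> a b c a0 b0 c0; have := @cls_relator [:: (1, (a * b, c)); (-1, (a, c)); (-1, (b, c))].
  rewrite cls_feval !feval_cons feval_nil /= addr0 !mulrN1z mulr1z => H.
  apply/eqP; rewrite -subr_eq0 opprD H //.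
  by left; exists a, b, c.
- move=> a b c a0 b0 c0; have := @cls_relator [:: (1, (a, b * c)); (-1, (a, b)); (-1, (a, c))].
  rewrite cls_feval !feval_cons feval_nil /= addr0 !mulrN1z mulr1z => H.
  apply/eqP; rewrite -subr_eq0 opprD H //.
  by right; left; exists a, b, c.
- by move=> a a0 a1; apply: cls_relator; right; right; left; exists a.
Qed.
Lemma sy_root : sy (-1) (- z) = 0.
Proof. by apply: cls_relator; right; right; right. Qed.

Lemma fcoef_feval (B : zmodType) (c : L -> L -> B) (s : fsum L) (r : seq (L * L)) :
  uniq r -> {subset [seq t.2 | t <- s] <= r} ->
  feval c s = \sum_(p <- r) c p.1 p.2 *~ fcoef s p.
Proof.
move=> Ur; elim: s => [|x s IH] Hs.
  by rewrite feval_nil big1 // => p _; rewrite /fcoef big_nil.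
rewrite feval_cons IH; last by move=> p pin; apply: Hs; rewrite inE pin orbT.
have xr : x.2 \in r by apply: Hs; rewrite inE eqxx.
rewrite [RHS](eq_bigr (fun p => c p.1 p.2 *~ (if x.2 == p then x.1 else 0)
                           + c p.1 p.2 *~ fcoef s p)); last first.
  by move=> p _; rewrite -mulrzDr /fcoef big_cons; case: eqP => // _; rewrite add0r.
rewrite big_split /=; congr (_ + _).
rewrite (bigD1_seq x.2) //= eqxx big1 ?addr0 // => p.
by rewrite eq_sym => /negPf ->; rewrite mulr0z.
Qed.

(** Universal property of K_2(L)/Z_N. [Mzero] only asserts equality of coefficients, so everything
    is regrouped over one list [r] containing all pairs that occur. *)
Lemma Mzero_feval (B : zmodType) (c : L -> L -> B) (s : fsum L) :
  steinberg c -> c (-1) (- z) = 0 -> Mzero z s -> feval c s = 0.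
Proof.
move=> cP cz [rs [R1 H1]].
have rel0 x : x \in rs -> feval c x.2 = 0.
  move=> /R1; case=> [[a [b [d [a0 b0 d0 ->]]]]|].
    by rewrite !feval_cons feval_nil /= (stMl cP) // mulr1z !mulrN1z; zmodule.
  case=> [[a [b [d [a0 b0 d0 ->]]]]|].
    by rewrite !feval_cons feval_nil /= (stMr cP) // mulr1z !mulrN1z; zmodule.
  case=> [[a [a0 a1 ->]]|->]; rewrite feval_cons feval_nil /= mulr1z addr0 //.
  by rewrite st_sub1 // subr_eq0 eq_sym.
pose r := undup ([seq t.2 | t <- s] ++ flatten [seq [seq t.2 | t <- x.2] | x <- rs]).
rewrite (@fcoef_feval _ c s r) ?undup_uniq //; last first.
  by move=> p ps; rewrite mem_undup mem_cat ps.
transitivity (\sum_(p <- r) \sum_(x <- rs) c p.1 p.2 *~ fcoef x.2 p *~ x.1).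
  apply: eq_bigr => p _; rewrite H1 mulrz_sumr.
  by apply: eq_bigr => x _; rewrite mulrC mulrzA.
rewrite exchange_big big_seq big1 // => x xrs.
have := rel0 x xrs; rewrite (@fcoef_feval _ c x.2 r) ?undup_uniq //.
  by move=> E; rewrite -mulrz_suml E mul0rz.
move=> p px; rewrite mem_undup mem_cat; apply/orP; right; apply/flatten_mapP.
by exists x.
Qed.

Lemma cls_lift (B : zmodType) (c : L -> L -> B) s t :
  steinberg c -> c (-1) (- z) = 0 -> cls s = cls t -> feval c s = feval c t.
Proof.
move=> cP cz /eqP/clsP /(Mzero_feval cP cz); rewrite feval_cat.
have -> : feval c (fscale (-1) t) = - feval c t.
  rewrite /feval /fscale big_map -sumrN; apply: eq_bigr => x _ /=.
  by rewrite mulN1r mulrNz.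
by move/eqP; rewrite subr_eq0 => /eqP.
Qed.
End K2.

(** * Tame symbols and specialization at a point of a residue field *)

Section MulGroup.
Variable K : fieldType.
(** K^x in additive notation, as the target of tame symbols must be a [zmodType]. *)
Definition mulgrp := {x : K | x != 0}.
HB.instance Definition _ := [Choice of mulgrp by <:].
Definition mg1 : mulgrp := exist _ 1 (oner_neq0 K).
Definition mgM (x y : mulgrp) : mulgrp :=
  exist _ (val x * val y) (mulf_neq0 (valP x) (valP y)).
Definition mgV (x : mulgrp) : mulgrp :=
  exist _ (val x)^-1 (etrans (congr1 negb (invr_eq0 (val x))) (valP x)).
Lemma mgA : associative mgM. Proof. by move=> x y t; apply: val_inj; rewrite /= mulrA. Qed.
Lemma mgC : commutative mgM. Proof. by move=> x y; apply: val_inj; rewrite /= mulrC. Qed.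
Lemma mg1M : left_id mg1 mgM. Proof. by move=> x; apply: val_inj; rewrite /= mul1r. Qed.
Lemma mgVM : left_inverse mg1 mgV mgM.
Proof. by move=> x; apply: val_inj; rewrite /= mulVf // (valP x). Qed.
HB.instance Definition _ := GRing.isZmodule.Build mulgrp mgA mgC mg1M mgVM.

Definition mk (x : K) : mulgrp := insubd mg1 x.
Lemma mkK x : x != 0 -> val (mk x) = x.
Proof. by move=> x0; rewrite /mk insubdK. Qed.
Lemma mkM x y : x != 0 -> y != 0 -> mk (x * y) = mk x + mk y.
Proof. by move=> x0 y0; apply: val_inj; rewrite /= !mkK // mulf_neq0. Qed.
Lemma mk1 : mk 1 = 0.
Proof. by apply: val_inj; rewrite mkK ?oner_neq0. Qed.
Lemma mk_eq0 x : x != 0 -> mk x = 0 -> x = 1.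
Proof. by move=> x0 /(congr1 val); rewrite mkK. Qed.
Lemma mkV x : x != 0 -> mk x^-1 = - mk x.
Proof.
move=> x0; apply/eqP; rewrite -addr_eq0 -mkM ?invr_eq0 // mulVf //.
by rewrite mk1.
Qed.
Lemma mkX x n : x != 0 -> mk (x ^+ n) = mk x *+ n.
Proof.
move=> x0; elim: n => [|n IH]; first by rewrite mk1.
by rewrite exprS mkM ?expf_neq0 // IH mulrS.
Qed.
Lemma mk_prod (I : Type) (r : seq I) (P : pred I) (F : I -> K) :
  (forall i, P i -> F i != 0) -> mk (\prod_(i <- r | P i) F i) = \sum_(i <- r | P i) mk (F i).
Proof.
move=> F0; elim: r => [|i r IH]; first by rewrite !big_nil mk1.
rewrite !big_cons; case: ifP => // Pi; rewrite mkM ?F0 ?IH //.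
by apply: (big_ind (fun x => x != 0)) => [|x y|]; rewrite ?oner_neq0 //; apply: mulf_neq0.
Qed.
Lemma mkN1 : mk (-1) *+ 2 = 0.
Proof. by rewrite -mkX ?oppr_eq0 ?oner_neq0 // sqrrN expr1n mk1. Qed.
End MulGroup.

(** A discrete valuation on a ring where it is nonnegative, with the residue of f divided by the
    power v f of a uniformizer. No axiom covers cancelling leading coefficients; there the Steinberg
    relation follows from lc g = - lc f. *)
Record leading_coef (R : idomainType) (K : fieldType) (v : R -> nat) (lc : R -> K) : Prop :=
  LeadingCoef {
  lc_neq0 : forall f, f != 0 -> lc f != 0;
  vM : forall f g, f != 0 -> g != 0 -> v (f * g) = (v f + v g)%N;
  lcM : forall f g, f != 0 -> g != 0 -> lc (f * g) = lc f * lc g;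
  vD_lt : forall f g, f != 0 -> g != 0 -> f + g != 0 -> (v f < v g)%N ->
    v (f + g) = v f /\ lc (f + g) = lc f;
  vD_eq : forall f g, f != 0 -> g != 0 -> f + g != 0 -> v f = v g -> lc f + lc g != 0 ->
    v (f + g) = v f /\ lc (f + g) = lc f + lc g }.

(** Additive form of the residue of (-1)^(v f v g) f^(v g) / g^(v f); powers of the uniformizer
    cancel, so leading coefficients compute it. *)
Definition tame (R : idomainType) (K : fieldType) (v : R -> nat) (lc : R -> K) (f g : R) :=
  mk (-1) *+ (v f * v g) + mk (lc f) *+ v g - mk (lc g) *+ v f : mulgrp K.

Lemma order2_parity (B : zmodType) (e : B) m n :
  e *+ 2 = 0 -> odd m = odd n -> e *+ m = e *+ n.
Proof.
move=> e2 mn; rewrite -[m]odd_double_half -[n]odd_double_half mn.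
by rewrite !mulrnDr -!mul2n !mulrnA e2 !mul0rn.
Qed.

Section LeadingCoef.
Variables (R : idomainType) (K : fieldType) (v : R -> nat) (lc : R -> K).
Hypothesis VP : leading_coef v lc.

Lemma vD_gt f g : f != 0 -> g != 0 -> f + g != 0 -> (v g < v f)%N ->
  v (f + g) = v g /\ lc (f + g) = lc g.
Proof. by move=> f0 g0; rewrite addrC; apply: (vD_lt VP). Qed.

Lemma tame_steinberg : steinberg (tame v lc).
Proof.
have n1 : -1 != 0 :> K by rewrite oppr_eq0 oner_neq0.
split=> [f g h f0 g0 h0|f g h f0 g0 h0|f g f0 g0 h0]; rewrite /tame.
- rewrite (vM VP) // (lcM VP) // mkM ?(lc_neq0 VP) // mulnDl !mulrnDr mulrnDl.
  zmodule.
- rewrite (vM VP) // (lcM VP) // mkM ?(lc_neq0 VP) // mulnDr !mulrnDr mulrnDl.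
  zmodule.
have [lt|gt|eq] := ltngtP (v f) (v g).
- by have [-> ->] := vD_lt VP f0 g0 h0 lt; zmodule.
- by have [-> ->] := vD_gt f0 g0 h0 gt; zmodule.
have [s0|s0] := eqVneq (lc f + lc g) 0; last first.
  by have [-> ->] := vD_eq VP f0 g0 h0 eq s0; rewrite eq; zmodule.
have -> : lc g = -1 * lc f by apply/eqP; rewrite mulN1r -addr_eq0 addrC s0.
(* Whatever k is, the leading coefficients cancel; what is left is a multiple of the 2-torsion
   element [mk (-1)], and n * n = n modulo 2. *)
rewrite mkM ?(lc_neq0 VP) // -eq; set m := v f; set k := v (f + g).
rewrite !mulrnDl.
rewrite (@order2_parity _ (mk (-1)) (m * m) m) ?mkN1 ?oddM ?andbb //.
rewrite (@order2_parity _ (mk (-1)) (k * k) k) ?mkN1 ?oddM ?andbb //.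
rewrite (@order2_parity _ (mk (-1)) (k * m) (m * k)) ?mkN1 ?oddM 1?andbC //.
have E n : (mk (-1) : mulgrp K) *+ n *+ 2 = 0 by rewrite -mulrnA mulnC mulrnA mkN1 mul0rn.
transitivity ((mk (-1) : mulgrp K) *+ k *+ 2 - mk (-1) *+ (m * k) *+ 2); first zmodule.
by rewrite !E subrr.
Qed.

(** The specialization map attached to a uniformizer. When the leading coefficients a and -a cancel,
    S a (-a) = 0 and the rest collapses by antisymmetry and [st_diag]. *)
Lemma specialize_steinberg (B : zmodType) (S : K -> K -> B) :
  steinberg S -> steinberg (fun f g => S (lc f) (lc g)).
Proof.
move=> SP; split=> [f g h f0 g0 h0|f g h f0 g0 h0|f g f0 g0 h0].
- by rewrite (lcM VP) // (stMl SP) ?(lc_neq0 VP).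
- by rewrite (lcM VP) // (stMr SP) ?(lc_neq0 VP).
have [lt|gt|eq] := ltngtP (v f) (v g).
- by have [_ ->] := vD_lt VP f0 g0 h0 lt; zmodule.
- by have [_ ->] := vD_gt f0 g0 h0 gt; zmodule.
have [s0|s0] := eqVneq (lc f + lc g) 0; last first.
  have [_ ->] := vD_eq VP f0 g0 h0 eq s0.
  by apply: (stD SP); rewrite ?(lc_neq0 VP).
have a0 := lc_neq0 VP f0; have c0 := lc_neq0 VP h0.
have -> : lc g = - lc f by apply/eqP; rewrite -addr_eq0 addrC s0.
rewrite (stN SP) // -mulN1r (stMr SP) ?oppr_eq0 ?oner_neq0 // (st_diag SP) //.
rewrite [S (lc (f + g)) (lc f)](st_anti SP) //; zmodule.
Qed.
End LeadingCoef.

Section Place.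
Variables (L K : fieldType) (io : {rmorphism L -> K}) (tau : K).
(** Places are points tau of extensions K of L rather than irreducible polynomials, with uniformizer
    X - tau; residues are then computed by evaluation in K. *)
Definition pv (f : {poly L}) := mup tau (map_poly io f).
Definition plc (f : {poly L}) := (map_poly io f %/ ('X - tau%:P) ^+ pv f).[tau].

Lemma place_spec f q n : map_poly io f = q * ('X - tau%:P) ^+ n -> q.[tau] != 0 ->
  pv f = n /\ plc f = q.[tau].
Proof.
move=> E q0; have E1 : pv f = n.
  rewrite /pv E mupMr ?mup_XsubCX ?eqxx //.
by split=> //; rewrite /plc E1 E mulpK // expf_neq0 // polyXsubC_eq0.
Qed.
Lemma place_ex f : f != 0 ->
  exists q, map_poly io f = q * ('X - tau%:P) ^+ pv f /\ q.[tau] = plc f /\ plc f != 0.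
Proof.
move=> f0; have [n [q]] := multiplicity_XsubC (map_poly io f) tau.
rewrite map_poly_eq0 f0 /= => q0 E; have [-> ->] := place_spec E q0.
by exists q.
Qed.
Lemma place_unit f : (map_poly io f).[tau] != 0 -> pv f = 0%N /\ plc f = (map_poly io f).[tau].
Proof. by move=> f0; apply: place_spec; rewrite // expr0 mulr1. Qed.
Lemma place_simple f : (map_poly io f).[tau] = 0 -> (map_poly io f)^`().[tau] != 0 ->
  pv f = 1%N /\ plc f = (map_poly io f)^`().[tau].
Proof.
move=> /eqP/factor_theorem[q E]; rewrite E derivM hornerD !hornerM derivXsubC.
rewrite !hornerE subrr mulr0 add0r => q0.
by apply: place_spec; rewrite ?expr1.
Qed.
Lemma place_leading : leading_coef pv plc.
Proof.
have split_sum (f g : {poly L}) q r : f != 0 -> g != 0 -> (pv f <= pv g)%N ->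
  map_poly io f = q * ('X - tau%:P) ^+ pv f -> map_poly io g = r * ('X - tau%:P) ^+ pv g ->
  map_poly io (f + g) = (q + r * ('X - tau%:P) ^+ (pv g - pv f)) * ('X - tau%:P) ^+ pv f.
  by move=> f0 g0 le Ef Eg; rewrite rmorphD /= {1}Ef {1}Eg mulrDl -mulrA -exprD subnK.
split.
- by move=> f /place_ex[q [_ []]].
- move=> f g /place_ex[q [Ef [q0 qn]]] /place_ex[r [Eg [r0 rn]]].
  have [|//|->//] := @place_spec (f * g) (q * r) (pv f + pv g).
    by rewrite rmorphM /= {1}Ef {1}Eg exprD mulrACA.
  by rewrite hornerM mulf_neq0 ?q0 ?r0.
- move=> f g /place_ex[q [Ef [q0 qn]]] /place_ex[r [Eg [r0 rn]]].
  have [||_ ->] := @place_spec (f * g) (q * r) (pv f + pv g).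
    by rewrite rmorphM /= {1}Ef {1}Eg exprD mulrACA.
  by rewrite hornerM mulf_neq0 ?q0 ?r0.
  by rewrite hornerM q0 r0.
- move=> f g f0 g0 h0 lt.
  have [q [Ef [q0 qn]]] := place_ex f0; have [r [Eg [r0 rn]]] := place_ex g0.
  have E := split_sum f g q r f0 g0 (ltnW lt) Ef Eg.
  have Eq : (q + r * ('X - tau%:P) ^+ (pv g - pv f)).[tau] = plc f.
    rewrite !hornerE subrr expr0n subn_eq0 leqNgt lt mulr0 addr0.
    exact: q0.
  by rewrite -Eq; apply: place_spec => //; rewrite Eq.
- move=> f g f0 g0 h0 eq s0.
  have [q [Ef [q0 qn]]] := place_ex f0; have [r [Eg [r0 rn]]] := place_ex g0.
  have E := split_sum f g q r f0 g0 _ Ef Eg.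
  have Eq : (q + r * ('X - tau%:P) ^+ (pv g - pv f)).[tau] = plc f + plc g.
    by rewrite eq subnn expr0 mulr1 hornerD q0 r0.
  by rewrite -Eq; apply: place_spec; rewrite ?Eq // E // eq.
Qed.
End Place.

(** * Unramified elements of K_2 of a rational function field *)

Lemma feval_perm (T : eqType) (B : zmodType) (c : T -> T -> B) s t :
  perm_eq s t -> feval c s = feval c t.
Proof. exact: perm_big. Qed.

Section Milnor.
Variable L : fieldType.
Local Notation R := {poly L}.
Definition psum := seq (int * (R * R)).
Implicit Types D : psum.

(* Equality of formal sums in the Milnor K_2 of L(t), tested by all Steinberg symbols. *)
Definition K2eq (D D' : psum) : Prop :=
  forall (B : zmodType) (c : R -> R -> B), steinberg c -> feval c D = feval c D'.

Definition psum_opp D : psum := [seq (- t.1, t.2) | t <- D].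
Lemma feval_opp (B : zmodType) (c : R -> R -> B) D : feval c (psum_opp D) = - feval c D.
Proof. by rewrite /feval big_map -sumrN; apply: eq_bigr => t _; rewrite mulrNz. Qed.

(** As [size] is the degree plus one, [bounded d] means degree less than d, and [bounded 1] means
    constant entries: the steps of Milnor's degree filtration. *)
Definition bounded d D :=
  all (fun t : int * (R * R) => [&& t.2.1 != 0, t.2.2 != 0, (size t.2.1 <= d)%N & (size t.2.2 <= d)%N]) D.

Lemma bounded_cat d D D' : bounded d (D ++ D') = bounded d D && bounded d D'.
Proof. exact: all_cat. Qed.
Lemma bounded_opp d D : bounded d (psum_opp D) = bounded d D.
Proof. by rewrite /bounded all_map. Qed.

Section Step.
Variable d : nat.
Hypothesis d0 : (0 < d)%N.

(** Generators {p, g} of the d-th graded piece of the filtration: one summand for each monic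
    irreducible p of degree d, with g representing a unit of L[t]/p. *)
Record top_pair (e : R * R) : Prop := TopPair {
  tp_irr : irreducible_poly e.1; tp_monic : e.1 \is monic; tp_size : size e.1 = d.+1;
  tp_neq0 : e.2 != 0; tp_lt : (size e.2 <= d)%N }.

Definition tops (E : seq (R * R)) : psum := [seq (1, e) | e <- E].
Lemma tops_cons e E : tops (e :: E) = (1, e) :: tops E. Proof. by []. Qed.

Definition reduced D := exists Dl E,
  [/\ bounded d Dl, forall e, e \in E -> top_pair e & K2eq D (Dl ++ tops E)].

Lemma sizeN1_le : (size (-1 : R)%R <= d)%N. Proof. by rewrite size_polyN size_poly1. Qed.
Lemma N1_neq0 : -1 != 0 :> R. Proof. by rewrite oppr_eq0 oner_neq0. Qed.

Lemma irreducible_low (p g : R) : irreducible_poly p -> g != 0 -> (size g < size p)%N ->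
  coprimep p g.
Proof.
move=> ip g0 lt; rewrite irreducible_poly_coprime //.
by apply: contraL lt => dv; rewrite -leqNgt dvdp_leq.
Qed.

(* Milnor: modulo symbols of lower degree, g |-> {p, g} is multiplicative modulo p. *)
Lemma top_merge p g1 g2 : top_pair (p, g1) -> top_pair (p, g2) ->
  exists Dl, [/\ bounded d Dl, top_pair (p, (g1 * g2) %% p) &
    K2eq (tops [:: (p, g1); (p, g2)]) (Dl ++ tops [:: (p, (g1 * g2) %% p)])].
Proof.
move=> [/= ip mp sp g10 s1] [/= _ _ _ g20 s2]; set h := g1 * g2; set r := h %% p.
have p0 := monic_neq0 mp; have h0 : h != 0 by rewrite mulf_neq0.
have r0 : r != 0.
  rewrite /r; have : ~~ (p %| h).
    rewrite -irreducible_poly_coprime // coprimepMr !irreducible_low // sp ltnS //.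
  by rewrite /dvdp.
have sr : (size r <= d)%N by rewrite -ltnS -sp ltn_modp.
have tr : top_pair (p, r) by [].
set q := h %/ p; have Eh : q * p + r = h by rewrite -divp_eq.
have [q0|q0] := eqVneq q 0.
  exists [::]; split=> // B c cP; rewrite !feval_cons /= feval_nil !addr0 !mulr1z.
  by rewrite -(stMr cP) // -/h -Eh q0 mul0r add0r.
have sq : (size q <= d)%N.
  rewrite /q size_divp // sp leq_subLR (leq_trans (size_polyMleq _ _)) //.
  by move: (size g1) (size g2) s1 s2 => a b; lia.
(* Read off from [stD] applied to q p + r = g1 g2, solved for {p, g1} + {p, g2} - {p, r}. *)
exists [:: (1, (q, r)); (-1, (q, g1)); (-1, (q, g2)); (-1, (g1, r)); (-1, (g2, r));
          (1, (g1, -1)); (1, (g2, -1))]; split=> //.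
  by rewrite /bounded /= N1_neq0 sizeN1_le q0 r0 g10 g20 s1 s2 sq sr.
move=> B c cP; rewrite !feval_cons /= feval_nil !addr0 !mulr1z !mulrN1z.
have qp0 : q * p != 0 by rewrite mulf_neq0.
have := stD cP qp0 r0; rewrite Eh => /(_ h0).
rewrite (st_diag cP) // !(stMl cP) // ?N1_neq0 // !(stMr cP) //.
move=> E.
apply/eqP; rewrite -subr_eq0 -oppr_eq0 -E; apply/eqP; zmodule.
Qed.

Lemma reduced_K2eq D D' : K2eq D D' -> reduced D' -> reduced D.
Proof.
move=> E [Dl [E' [? ? H]]]; exists Dl, E'; split=> // B c cP.
by rewrite E // H.
Qed.
Lemma reduced_cat D D' : reduced D -> reduced D' -> reduced (D ++ D').
Proof.
move=> [Dl [E [b t H]]] [Dl' [E' [b' t' H']]]; exists (Dl ++ Dl'), (E ++ E'); split.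
- by rewrite bounded_cat b.
- by move=> e; rewrite mem_cat => /orP[/t|/t'].
move=> B c cP; rewrite /tops map_cat !feval_cat H // H' // !feval_cat; zmodule.
Qed.
Lemma reduced_low D : bounded d D -> reduced D.
Proof. by move=> b; exists D, [::]; split=> // B c cP; rewrite cats0. Qed.

(** [tops] allows only coefficient 1. With r the inverse of g modulo p, [top_merge] turns {p, g} +
    {p, r} into {p, 1} = 0 up to lower terms. *)
Lemma reduced_opp_top e : top_pair e -> reduced [:: (-1, e)].
Proof.
case: e => p g te; have [/= ip mp sp g0 sg] := te; have p0 := monic_neq0 mp.
have := irreducible_low ip g0; rewrite sp ltnS => /(_ sg) /Bezout_eq1_coprimepP[[u v] /= Euv].
set r := v %% p.
have Er : (g * r) %% p = 1.
  have Ev : v * g = - u * p + 1 by rewrite -Euv mulNr addKr.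
  rewrite modp_mul mulrC Ev modp_addl_mul_small //.
  by rewrite size_poly1 sp ltnS.
have r0 : r != 0.
  by apply: contraTneq isT => r0; move: Er; rewrite r0 mulr0 mod0p => /esym/eqP; rewrite oner_eq0.
have tr : top_pair (p, r) by split=> //=; rewrite -ltnS -sp ltn_modp.
have [Dl [bl _ H]] := top_merge te tr; rewrite Er in H.
exists (psum_opp Dl), [:: (p, r)]; split.
- by rewrite bounded_opp.
- by move=> e; rewrite inE => /eqP ->.
move=> B c cP; have := H B c cP; rewrite !(feval_cat, feval_cons) /= !feval_nil feval_opp.
rewrite !mulr1z mulrN1z (st1r cP) // !addr0 => E.
by apply/eqP; rewrite -subr_eq0 -oppr_eq0 -[X in _ == X](subrr (feval c Dl)) -{1}E; apply/eqP; zmodule.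
Qed.
Lemma reduced_opp D : reduced D -> reduced (psum_opp D).
Proof.
move=> [Dl [E [b t H]]].
apply: (@reduced_K2eq _ (psum_opp Dl ++ psum_opp (tops E))).
  by move=> B c cP; rewrite feval_cat !feval_opp H // feval_cat opprD.
apply: reduced_cat; first by apply: reduced_low; rewrite bounded_opp.
elim: E t {H} => [|e E IH] t; first exact: reduced_low.
apply: (@reduced_cat [:: (-1, e)]).
  by apply: reduced_opp_top; apply: t; rewrite inE eqxx.
by apply: IH => e' e'E; apply: t; rewrite inE e'E orbT.
Qed.
Lemma reduced_scale (n : int) fg : reduced [:: (1, fg)] -> reduced [:: (n, fg)].
Proof.
move=> H; have P (m : nat) : reduced [:: (m%:Z, fg)].
  elim: m => [|m IH].
    by apply: reduced_K2eq (reduced_low (isT : bounded d [::])) => B c cP;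
       rewrite feval_cons feval_nil mulr0z addr0.
  apply: reduced_K2eq (reduced_cat H IH) => B c cP.
  by rewrite feval_cat !feval_cons feval_nil !addr0 -addn1 PoszD mulrzDr addrC.
case: n => n; first exact: P.
apply: reduced_K2eq (reduced_opp (P n.+1)) => B c cP.
by rewrite feval_opp !feval_cons feval_nil !addr0 -mulrNz.
Qed.

Lemma reduced_Ml f1 f2 g : f1 != 0 -> f2 != 0 -> g != 0 ->
  reduced [:: (1, (f1, g))] -> reduced [:: (1, (f2, g))] -> reduced [:: (1, (f1 * f2, g))].
Proof.
move=> f10 f20 g0 H1 H2; apply: reduced_K2eq (reduced_cat H1 H2) => B c cP.
by rewrite feval_cat !feval_cons feval_nil /= !addr0 !mulr1z (stMl cP).
Qed.
Lemma reduced_swap f g : f != 0 -> g != 0 ->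
  reduced [:: (1, (f, g))] -> reduced [:: (1, (g, f))].
Proof.
move=> f0 g0 H; apply: reduced_K2eq (reduced_opp H) => B c cP.
by rewrite feval_opp !feval_cons feval_nil /= !addr0 !mulr1z (st_anti cP).
Qed.

Definition low (f : R) := f != 0 /\ (size f <= d)%N.
Definition top (f : R) := [/\ irreducible_poly f, f \is monic & size f = d.+1].

Lemma reduced_top_low p g : top p -> low g -> reduced [:: (1, (p, g))].
Proof.
move=> [ip mp sp] [g0 sg]; exists [::], [:: (p, g)]; split=> //.
by move=> e; rewrite inE => /eqP ->.
Qed.
(** Two monic polynomials of equal degree differ by one of lower degree, and [stD] for p + (q - p) =
    q gives {p, q} = {p, q - p} - {q, q - p} + {q, -1}. *)
Lemma reduced_top_top p q : top p -> top q -> reduced [:: (1, (p, q))].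
Proof.
move=> tp tq; have [ip mp sp] := tp; have [iq mq sq] := tq.
have p0 := monic_neq0 mp; have q0 := monic_neq0 mq.
have l1 : low (-1) by split; [exact: N1_neq0|exact: sizeN1_le].
have [<-|neq] := eqVneq p q.
  apply: reduced_K2eq (reduced_top_low tp l1) => B c cP.
  by rewrite !feval_cons feval_nil /= (st_diag cP).
have r0 : q - p != 0 by rewrite subr_eq0 eq_sym.
have lr : low (q - p).
  split=> //; rewrite -ltnS -sp; apply: (@leq_ltn_trans (size p).-1); last by rewrite sp.
  apply/leq_sizeP => j; rewrite leq_eqVlt coefB => /orP[/eqP <-|lt].
    by rewrite {1}sp -sq -!lead_coefE (monicP mp) (monicP mq) subrr.
  by rewrite !nth_default ?subrr // ?sp ?sq; move: lt; rewrite sp.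
have H := reduced_cat (reduced_cat (reduced_top_low tp lr) (reduced_opp (reduced_top_low tq lr)))
            (reduced_top_low tq l1).
apply: reduced_K2eq H => B c cP.
rewrite !(feval_cat, feval_opp, feval_cons) feval_nil /= !addr0 !mulr1z.
have := stD cP p0 r0; rewrite addrC subrK (st_diag cP q0) => /(_ q0) E.
by apply/eqP; rewrite -subr_eq0 -oppr_eq0 -E; apply/eqP; zmodule.
Qed.

(** A polynomial of degree exactly d is a constant times a monic irreducible one, or a product of
    two factors of smaller degree. *)
Lemma low_top_ind (P : R -> Prop) :
  (forall f g, f != 0 -> g != 0 -> P f -> P g -> P (f * g)) ->
  (forall f, low f -> P f) -> (forall f, top f -> P f) ->
  forall f : R, f != 0 -> (size f <= d.+1)%N -> P f.
Proof.
move=> PM Pl Pt f f0; rewrite leq_eqVlt => /orP[/eqP sf|sf]; last first.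
  by apply: Pl; split.
have lc0 : lead_coef f != 0 by rewrite lead_coef_eq0.
have [irr|red] := pselect (irreducible_poly f).
  have -> : f = (lead_coef f)%:P * ((lead_coef f)^-1 *: f).
    by rewrite mul_polyC scalerA divff // scale1r.
  apply: PM; rewrite ?polyC_eq0 ?scaler_eq0 ?invr_eq0 ?negb_or ?lc0 //.
    by apply: Pl; split; rewrite ?polyC_eq0 // (leq_trans (size_polyC_leq1 _)).
  apply: Pt; split.
  - split; first by rewrite size_scale ?invr_eq0 // sf.
    move=> q sq; rewrite dvdpZr ?invr_eq0 // => /(irr.2 q sq) /eqp_trans; apply.
    by rewrite eqp_sym eqp_scale // invr_eq0.
  - by apply/monicP; rewrite lead_coefZ mulVf.
  - by rewrite size_scale ?invr_eq0.
have [q [sq qf nqf]] : exists q : R, [/\ size q != 1%N, q %| f & ~~ (q %= f)].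
  apply: contrapT => H; apply: red; split; first by rewrite sf.
  move=> q sq qf; apply: contrapT => nqf; apply: H; exists q; split=> //; exact/negP.
have Ef := divpK qf; have q0 : q != 0 by apply: contraNneq f0 => q0; rewrite -Ef q0 mulr0.
have r0 : f %/ q != 0 by apply: contraNneq f0 => r0; rewrite -Ef r0 mul0r.
have sq1 : (1 < size q)%N by move: sq q0; rewrite -size_poly_gt0; case: (size q) => [|[]].
rewrite -Ef; apply: PM => //; apply: Pl; split=> //.
  by rewrite size_divp // sf leq_subLR; move: (size q) sq1 => a; lia.
rewrite -ltnS -sf ltn_neqAle dvdp_leq // andbT.
by apply: contra nqf => sqf; rewrite -dvdp_size_eqp.
Qed.

Lemma reduced_pair (f g : R) : f != 0 -> g != 0 -> (size f <= d.+1)%N -> (size g <= d.+1)%N ->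
  reduced [:: (1, (f, g))].
Proof.
move=> f0 g0 sf sg.
have top0 h : top h -> h != 0 by move=> [_ /monic_neq0].
move: f f0 sf; apply: low_top_ind => [f1 f2 f10 f20 H1 H2|f lf|f tf].
- exact: reduced_Ml.
- move: g g0 sg; apply: low_top_ind => [g1 g2 g10 g20 H1 H2|g lg|g tg].
  + apply: reduced_swap; [exact: mulf_neq0|by case: lf|].
    by apply: reduced_Ml => //; [by case: lf| |]; apply: reduced_swap => //; case: lf.
  + by apply: reduced_low; case: lf lg => [f0 sf] [g0 sg]; rewrite /bounded /= f0 g0 sf sg.
  + by apply: reduced_swap; [exact: top0|case: lf|exact: reduced_top_low].
move: g g0 sg; apply: low_top_ind => [g1 g2 g10 g20 H1 H2|g lg|g tg].
- apply: reduced_swap; [exact: mulf_neq0|exact: top0|].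
  by apply: reduced_Ml => //; [exact: top0| |]; apply: reduced_swap => //; exact: top0.
- exact: reduced_top_low.
- exact: reduced_top_top.
Qed.

Lemma reduced_bounded D : bounded d.+1 D -> reduced D.
Proof.
elim: D => [|[n [f g]] D IH] /=; first by move=> _; exact: reduced_low.
case/andP=> /and4P[/= f0 g0 sf sg] /IH H; apply: (@reduced_cat [:: _]) => //.
by apply: reduced_scale; exact: reduced_pair.
Qed.
End Step.

(** Only finite places occur: for a rational function field they already detect everything outside
    K_2 of the constants. *)
Definition unramified D :=
  forall (K : fieldType) (io : {rmorphism L -> K}) (tau : K), feval (tame (pv io tau) (plc io tau)) D = 0.

Hypothesis L0 : forall n, n.+1%:R != 0 :> L.

Lemma tame_unit (K : fieldType) (io : {rmorphism L -> K}) (tau : K) (f g : R) :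
  (map_poly io f).[tau] != 0 -> (map_poly io g).[tau] != 0 ->
  tame (pv io tau) (plc io tau) f g = 0.
Proof.
move=> /place_unit[vf _] /place_unit[vg _].
by rewrite /tame vf vg !mulr0n addr0 subr0.
Qed.

Lemma root_irreducible (K : fieldType) (io : {rmorphism L -> K}) (tau : K) (p g : R) :
  coprimep p g -> root (map_poly io p) tau -> (map_poly io g).[tau] != 0.
Proof.
move=> /Bezout_eq1_coprimepP[[u v] /= E] /rootP rp; apply/eqP => rg.
have := congr1 (fun q => (map_poly io q).[tau]) E.
rewrite rmorphD !rmorphM rmorph1 !hornerE rp rg !mulr0 addr0 => /esym/eqP.
by rewrite oner_eq0.
Qed.

Lemma deriv_neq0 (p : R) : (1 < size p)%N -> p^`() != 0.
Proof.
move=> sp; apply/eqP => /(congr1 (fun q : R => q`_(size p).-2)); rewrite coef_deriv coef0.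
have -> : (size p).-2.+1 = (size p).-1 by move: sp; case: (size p) => [|[]].
move/eqP; rewrite -lead_coefE -mulr_natr mulf_eq0 lead_coef_eq0 => /orP[/eqP p0|].
  by move: sp; rewrite p0 size_poly0.
by apply/negP; have -> : (size p).-1 = (size p).-2.+1 by move: sp; case: (size p) => [|[]].
Qed.

(** Pairs with the same p are merged until the first p occurs once. At a root tau of p only {p, g}
    then has a nontrivial tame symbol, namely g(tau)^-1, so g - 1 vanishes at tau; having degree
    below that of p, it is 0. *)
Lemma tops_unramified d E : (0 < d)%N -> (forall e, e \in E -> top_pair d e) ->
  forall D Dl, K2eq D (Dl ++ tops E) -> bounded d Dl -> unramified D ->
  exists2 Dl', bounded d Dl' & K2eq D Dl'.
Proof.
move=> d0; have [n] := ubnP (size E); elim: n E => // n IH [|[p g] E] /= sE tE D Dl H bl ur.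
  by exists Dl => //; rewrite cats0 in H.
have te : top_pair d (p, g) by apply: tE; rewrite inE eqxx.
have [/= ip mp sp g0 sg] := te; have p0 := monic_neq0 mp.
have [/mapP[[p' g2] pE /= Ep]|pE] := boolP (p \in [seq e.1 | e <- E]).
  rewrite -Ep in pE; have te2 : top_pair d (p, g2) by apply: tE; rewrite inE pE orbT.
  have [Dl' [bl' t3 H']] := top_merge d0 te te2.
  apply: (IH ((p, (g * g2) %% p) :: rem (p, g2) E) _ _ D (Dl ++ Dl')) => //.
  - by rewrite /= size_rem //; move: sE; case: (E) pE.
  - move=> e; rewrite inE => /orP[/eqP -> //|/mem_rem eE].
    by apply: tE; rewrite inE eE orbT.
  - move=> B c cP; rewrite H // !feval_cat /=.
    have -> : feval c (tops ((p, g) :: E)) =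
        feval c (tops [:: (p, g); (p, g2)]) + feval c (tops (rem (p, g2) E)).
      rewrite -feval_cat; apply: feval_perm; rewrite -map_cat perm_map //= perm_cons.
      exact: perm_to_rem.
    rewrite H' // !feval_cat !tops_cons !feval_cons !feval_nil; zmodule.
  - by rewrite bounded_cat bl.
have [K _ [tau rt _]] := irredp_FAdjoin ip; pose io : {rmorphism L -> K} := GRing.in_alg K.
have low_unit (h : R) : h != 0 -> (size h <= d)%N -> (map_poly io h).[tau] != 0.
  by move=> h0 sh; apply: root_irreducible rt; apply: irreducible_low; rewrite // sp.
have other_unit e : e \in E -> (map_poly io e.1).[tau] != 0.
  move=> eE; have [iq mq sq _ _] : top_pair d e by apply: tE; rewrite inE eE orbT.
  apply: root_irreducible rt; rewrite irreducible_poly_coprime //.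
  apply: contra pE => dv; apply/mapP; exists e => //; apply/eqP.
  by rewrite -eqp_monic // -dvdp_size_eqp // sp sq.
have T0 := ur K io tau; have TP := tame_steinberg (place_leading io tau).
rewrite H // feval_cat feval_cons /= mulr1z in T0.
have z1 : feval (tame (pv io tau) (plc io tau)) Dl = 0.
  rewrite /feval big_seq big1 // => t tD; move/allP: bl => /(_ t tD) /and4P[f0 h0 sf sh].
  by rewrite tame_unit ?mul0rz // low_unit.
have z2 : feval (tame (pv io tau) (plc io tau)) (tops E) = 0.
  rewrite /feval big_map big_seq big1 // => e eE /=.
  have [_ _ _ h0 sh] : top_pair d e by apply: tE; rewrite inE eE orbT.
  by rewrite tame_unit ?mul0rz ?other_unit ?low_unit.
(* Characteristic zero makes p separable, so tau is a simple root. *)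
have [vp _] : pv io tau p = 1%N /\ plc io tau p = (map_poly io p)^`().[tau].
  apply: place_simple; first exact/rootP.
  rewrite deriv_map; apply: low_unit; first by apply: deriv_neq0; rewrite sp ltnS.
  by rewrite -ltnS -sp lt_size_deriv.
have [vg lg] := place_unit (low_unit g g0 sg).
have gv : (map_poly io g).[tau] = 1.
  apply: mk_eq0; first exact: low_unit.
  move: T0; rewrite z1 z2 add0r addr0 /tame vp vg muln0 lg !mulr0n mulr1n !add0r.
  by move/eqP; rewrite oppr_eq0 => /eqP.
have g1 : g = 1.
  apply/eqP; rewrite -subr_eq0; apply: contraTT isT => h0.
  have := low_unit _ h0; rewrite rmorphB rmorph1 !hornerE gv subrr eqxx; apply.
  by rewrite (leq_trans (size_polyD _ _)) // geq_max sg size_polyN size_poly1.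
apply: (IH E _ _ D Dl) => //; first by move=> e eE; apply: tE; rewrite inE eE orbT.
by move=> B c cP; rewrite H // !feval_cat feval_cons /= g1 (st1r cP) // mul0rz add0r.
Qed.

(* The injectivity half of Milnor's computation of K_2 of a rational function field. *)
Theorem unramified_constant D d : bounded d.+1 D -> unramified D ->
  exists2 D0, bounded 1 D0 & K2eq D D0.
Proof.
elim: d D => [|d IH] D bD ur; first by exists D.
have [Dl [E [bl tE H]]] := reduced_bounded (ltn0Sn d) bD.
have [D1 b1 H1] := tops_unramified (ltn0Sn d) tE H bl ur.
have ur1 : unramified D1.
  by move=> K io tau; rewrite -H1 //; apply/tame_steinberg/place_leading.
have [D0 b0 H0] := IH D1 b1 ur1.
by exists D0 => // B c cP; rewrite H1 // H0.
Qed.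

(** How Milnor's theorem is used: two specializations of L(t) restrict to the same symbol on L,
    hence agree on every unramified element. *)
Corollary unramified_eval (B : zmodType) (c c' : R -> R -> B) D :
  steinberg c -> steinberg c' ->
  (forall a b, a != 0 -> b != 0 -> c a%:P b%:P = c' a%:P b%:P) ->
  all (fun t : int * (R * R) => (t.2.1 != 0) && (t.2.2 != 0)) D -> unramified D ->
  feval c D = feval c' D.
Proof.
move=> cP c'P cc' nz ur.
have [d bD] : exists d, bounded d.+1 D.
  exists (\max_(t <- D) maxn (size t.2.1) (size t.2.2)); apply/allP => t tD.
  have /andP[-> ->] := allP nz t tD.
  have := @leq_bigmax_seq _ D xpredT (fun t : int * (R * R) => maxn (size t.2.1) (size t.2.2)) t tD isT.
  by rewrite geq_max => /andP[] /leqW -> /leqW ->.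
have [D0 b0 H0] := unramified_constant bD ur; rewrite !H0 //.
rewrite /feval big_seq [RHS]big_seq; apply: eq_bigr => t tD.
have /and4P[f0 g0 sf sg] := allP b0 t tD.
rewrite (size1_polyC sf) (size1_polyC sg) cc' //.
  by rewrite -polyC_eq0 -size1_polyC.
by rewrite -polyC_eq0 -size1_polyC.
Qed.
End Milnor.

(** * Primitive vectors of Z^2, potentials and cone paths *)

Lemma intM1 (x y : int) : x * y = 1 -> x = 1 /\ y = 1 \/ x = -1 /\ y = -1.
Proof.
move=> E; have xu : x \is a GRing.unit by apply/unitrPr; exists y.
have /orP[/eqP x1|/eqP x1] : (x == 1) || (x == -1) by move: xu; rewrite qualifE /=; lia.
  by left; move: E; rewrite x1; lia.
by right; move: E; rewrite x1; lia.
Qed.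

Definition vec := (int * int)%type.
Definition det2 (u v : vec) : int := u.1 * v.2 - v.1 * u.2.
Definition prim (v : vec) := coprimez v.1 v.2.

Lemma vec_eq (u v : vec) : u.1 = v.1 -> u.2 = v.2 -> u = v.
Proof. by case: u v => [a b] [c d] /= -> ->. Qed.
Lemma vD1 (u v : vec) : (u + v).1 = u.1 + v.1. Proof. by []. Qed.
Lemma vD2 (u v : vec) : (u + v).2 = u.2 + v.2. Proof. by []. Qed.
Lemma vN1 (u : vec) : (- u).1 = - u.1. Proof. by []. Qed.
Lemma vN2 (u : vec) : (- u).2 = - u.2. Proof. by []. Qed.
Definition vscale (k : int) (u : vec) : vec := (k * u.1, k * u.2).
Lemma vZ1 k u : (vscale k u).1 = k * u.1. Proof. by []. Qed.
Lemma vZ2 k u : (vscale k u).2 = k * u.2. Proof. by []. Qed.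
Definition vE := (vD1, vD2, vN1, vN2, vZ1, vZ2).

Lemma det2Dl u v w : det2 (u + v) w = det2 u w + det2 v w.
Proof. by rewrite /det2 !vE; ring. Qed.
Lemma det2Dr u v w : det2 u (v + w) = det2 u v + det2 u w.
Proof. by rewrite /det2 !vE; ring. Qed.
Lemma det2Nl u v : det2 (- u) v = - det2 u v.
Proof. by rewrite /det2 !vE; ring. Qed.
Lemma det2Nr u v : det2 u (- v) = - det2 u v.
Proof. by rewrite /det2 !vE; ring. Qed.
Lemma det2Zl k u v : det2 (vscale k u) v = k * det2 u v.
Proof. by rewrite /det2 !vE; ring. Qed.
Lemma det2Zr k u v : det2 u (vscale k v) = k * det2 u v.
Proof. by rewrite /det2 !vE; ring. Qed.
Lemma det2C u v : det2 v u = - det2 u v.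
Proof. by rewrite /det2; ring. Qed.
Lemma det2vv u : det2 u u = 0.
Proof. by rewrite /det2; ring. Qed.
Definition det2E := (det2Dl, det2Dr, det2Nl, det2Nr, det2Zl, det2Zr, det2vv).
Lemma plucker p q w a : det2 p q * det2 w a - det2 p w * det2 q a + det2 p a * det2 q w = 0.
Proof. by rewrite /det2; ring. Qed.

(** Bezout coefficients complete a primitive v to the oriented bases (nbin v, v) and (v, nbout
    v). *)
Definition nbin (v : vec) : vec := ((egcdz v.2 v.1).1, - (egcdz v.2 v.1).2).
Definition nbout (v : vec) : vec := - nbin v.

Lemma det2_nbin v : prim v -> det2 (nbin v) v = 1.
Proof.
rewrite /prim coprimez_sym /coprimez /nbin /det2 /=.
by case: egcdzP => a b <- _ /eqP <-; ring.
Qed.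
Lemma det2_nbout v : prim v -> det2 v (nbout v) = 1.
Proof. by move=> pv; rewrite /nbout det2Nr det2C opprK det2_nbin. Qed.
Lemma det2_prim u v : det2 u v = 1 -> prim u /\ prim v.
Proof.
move=> E; split; apply/coprimezP.
  by exists (v.2, - v.1); rewrite -E /det2 /=; ring.
by exists (- u.2, u.1); rewrite -E /det2 /=; ring.
Qed.

Lemma det2_shift v w w' : det2 v w = 1 -> det2 v w' = 1 -> exists k, w' = w + vscale k v.
Proof.
move=> E E'; exists (det2 w' w).
have P1 : w'.1 = w.1 * det2 v w' + v.1 * det2 w' w - w'.1 * (det2 v w - 1).
  by rewrite /det2; ring.
have P2 : w'.2 = w.2 * det2 v w' + v.2 * det2 w' w - w'.2 * (det2 v w - 1).
  by rewrite /det2; ring.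
by apply: vec_eq; rewrite !vE ?[LHS]P1 ?[LHS]P2 E E' subrr mulr0 subr0 mulr1 mulrC.
Qed.

Lemma shift_inv (T : Type) (h : vec -> T) v :
  (forall w, det2 v w = 1 -> h w = h (w + v)) ->
  forall w w', det2 v w = 1 -> det2 v w' = 1 -> h w = h w'.
Proof.
move=> H w w' E E'; have [k ->] := det2_shift E E'.
have P (n : nat) u : det2 v u = 1 -> h u = h (u + vscale n%:Z v).
  move=> Eu; elim: n => [|n IH].
    by congr h; apply: vec_eq; rewrite !vE mul0r addr0.
  rewrite IH H ?det2E ?Eu ?mulr0 ?addr0 //.
  by congr h; apply: vec_eq; rewrite !vE -addn1 PoszD; ring.
case: k => n; first exact: P.
rewrite NegzE [RHS](P n.+1); last by rewrite !det2E E mulr0 addr0.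
by congr h; apply: vec_eq; rewrite !vE; ring.
Qed.

(** * Existence of potentials on primitive vectors *)

Section Potential.
Variables (B : zmodType) (f : vec -> vec -> B).
Hypothesis f3 : forall u v, det2 u v = 1 -> f u v = f u (u + v) + f (u + v) v.
Hypothesis f4 : forall u v, det2 u v = 1 ->
  f u v + f v (- u) + f (- u) (- v) + f (- v) u = 0.

Definition e1 : vec := (1, 0).
(** The Farey parent: among the vectors nbin v + k v, the one whose height (second coordinate) is
    reduced modulo that of v. *)
Definition par v : vec := nbin v - vscale ((nbin v).2 %/ v.2)%Z v.

Lemma par_spec v : prim v -> 1 < v.2 -> [/\ det2 (par v) v = 1, 0 < (par v).2 & (par v).2 < v.2].
Proof.
move=> pv v2; have Ed : det2 (par v) v = 1.
  by rewrite /par !(det2E, det2_nbin) //; ring.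
have E2 : (par v).2 = ((nbin v).2 %% v.2)%Z.
  by rewrite /par !vE {1}(divz_eq (nbin v).2 v.2); ring.
have v0 : v.2 != 0 by lia.
have ge := modz_ge0 (nbin v).2 v0; have lt := @ltz_pmod (nbin v).2 v.2.
rewrite E2; split=> //; last by apply: lt; lia.
have [E0|] := eqVneq ((nbin v).2 %% v.2)%Z 0; last by lia.
by move: Ed; rewrite /det2 E2 E0 mulr0 subr0 => /intM1; lia.
Qed.

Lemma par_uniq u v : det2 u v = 1 -> 0 < u.2 -> u.2 < v.2 -> u = par v.
Proof.
move=> E u0 uv; have [_ pv] := det2_prim E.
have [E' p0 pl] : [/\ det2 (par v) v = 1, 0 < (par v).2 & (par v).2 < v.2].
  by apply: par_spec => //; lia.
move: (par v) E' p0 pl => w E' p0 pl.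
have [||k Ek] := @det2_shift v (- u) (- w).
- by rewrite det2Nr det2C opprK.
- by rewrite det2Nr det2C opprK.
have := congr1 snd Ek; rewrite !vE => E2.
have k0 : k = 0 by nia.
move: Ek; rewrite k0 => Ek; apply: oppr_inj; rewrite Ek.
by apply: vec_eq; rewrite !vE mul0r addr0.
Qed.

(** Sum of f along the chain of Farey parents down to [e1], where the potential is 0; n is fuel
    bounding the height, and every vector v of height 1 forms an oriented basis (e1, v). *)
Fixpoint upot (n : nat) (v : vec) : B :=
  if n is n'.+1 then
    if v.2 == 1 then f e1 v else upot n' (par v) + f (par v) v
  else 0.

Lemma upot_fuel n m v : prim v -> 0 < v.2 -> v.2 <= n%:Z -> v.2 <= m%:Z -> upot n v = upot m v.
Proof.
elim: n m v => [|n IH] [|m] v pv v0 vn vm //=; [lia|lia|].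
case: eqP => // v1; have [E p0 pl] : [/\ det2 (par v) v = 1, 0 < (par v).2 & (par v).2 < v.2].
  by apply: par_spec => //; lia.
by rewrite (IH m) //; [exact: (det2_prim E).1|lia|lia].
Qed.

Definition hpot v : B := upot `|v.2|%N v.

Lemma hpot_edge_lt u v : det2 u v = 1 -> 0 <= u.2 -> u.2 < v.2 -> hpot v - hpot u = f u v.
Proof.
move=> E u0 uv; have [pu pv] := det2_prim E.
have [u20|u20] := eqVneq u.2 0.
  have [u1 v1] : u.1 = 1 /\ v.2 = 1.
    by move: E; rewrite /det2 u20 mulr0 subr0 => /intM1; lia.
  have -> : u = e1 by apply: vec_eq.
  by rewrite /hpot v1 /= v1 eqxx subr0.
have Eu : u = par v by apply: par_uniq => //; lia.
have -> : hpot v = upot `|v.2|.-1 u + f u v.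
  rewrite /hpot; have -> : `|v.2|%N = `|v.2|.-1.+1 by lia.
  by rewrite /= ifN -?Eu //; lia.
rewrite (@upot_fuel _ `|u.2|%N u) //; [|lia|lia|lia].
by rewrite /hpot; zmodule.
Qed.

(** Subtractive Euclid: if u is at least as high as v, the relation [f3] for the basis (u - v, v)
    reduces the edge to two edges starting at u - v. *)
Lemma hpot_edge u v : det2 u v = 1 -> 0 <= u.2 -> 0 < v.2 -> hpot v - hpot u = f u v.
Proof.
have [n] := ubnP (`|u.2| + `|v.2|)%N; elim: n u v => // n IH u v lt E u0 v0.
have [uv|vu] := ltP u.2 v.2; first exact: hpot_edge_lt.
have Eq : det2 (u - v) v = 1 by rewrite !det2E E oppr0 addr0.
have Eq' : det2 (u - v) u = 1 by rewrite !det2E det2C E; ring.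
have H1 : hpot v - hpot (u - v) = f (u - v) v.
  by apply: IH => //; rewrite ?vE; lia.
have H2 : hpot u - hpot (u - v) = f (u - v) u.
  by apply: hpot_edge_lt => //; rewrite !vE; lia.
have := f3 Eq; rewrite subrK -H1 -H2 => H.
by apply: (@addrI _ (hpot u - hpot (u - v))); rewrite -H; zmodule.
Qed.

(** Change of potential from v to -v by way of w. Two uses of [f3] show that it is the same for all
    w, so it can serve to extend the potential to the lower half plane. *)
Definition jump v w := f v w + f w (- v).

Lemma jump_inv v w w' : det2 v w = 1 -> det2 v w' = 1 -> jump v w = jump v w'.
Proof.
apply: shift_inv => {w w'} w E; rewrite /jump (f3 E).
have E' : det2 (v + w) (- v) = 1 by rewrite !det2E det2C E; ring.
have -> : w + v = v + w by rewrite addrC.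
have := f3 E'; have -> : v + w - v = w by rewrite addrC addKr.
by move=> ->; zmodule.
Qed.

Definition upper (v : vec) := (0 < v.2) || (v.2 == 0) && (0 < v.1).
Definition pot v : B :=
  if upper v then hpot v else hpot (- v) + jump (- v) (nbout (- v)).

Lemma upperN v : prim v -> ~~ upper v -> upper (- v).
Proof.
move=> pv; rewrite /upper !vE; have [v2|] := eqVneq v.2 0; last by lia.
suff : v.1 != 0 by lia.
by apply: contraTneq pv => v1; rewrite /prim v1 v2.
Qed.

Lemma pot_edge u v : det2 u v = 1 -> pot v - pot u = f u v.
Proof.
move=> E; have [pu pv] := det2_prim E.
have Ev : det2 (- v) u = 1 by rewrite det2Nl det2C opprK.
have Eu : det2 v (- u) = 1 by rewrite det2Nr det2C opprK.
have Euv : det2 (- u) (- v) = 1 by rewrite det2Nl det2Nr opprK.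
have pNu : prim (- u) by have [] := det2_prim Euv.
have pNv : prim (- v) by have [] := det2_prim Euv.
have key x y : det2 x y = 1 -> upper x -> upper y -> hpot y - hpot x = f x y.
  move=> Exy ux uy; apply: hpot_edge => //; first by move: ux; rewrite /upper; lia.
  move: ux uy Exy; rewrite /upper /det2.
  by have [y2|] := eqVneq y.2 0; [rewrite y2; nia|lia].
have Ju : jump (- u) (nbout (- u)) = f (- u) (- v) + f (- v) u.
  by rewrite (jump_inv (det2_nbout pNu) Euv) /jump opprK.
have Jv : jump (- v) (nbout (- v)) = f (- v) u + f u v.
  by rewrite (jump_inv (det2_nbout pNv) Ev) /jump opprK.
rewrite /pot; case: ifPn => uv; case: ifPn => uu.
- exact: key.
- have := key _ _ Eu uv (upperN pu uu); rewrite Ju => H.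
  by apply/eqP; rewrite -subr_eq0 -oppr_eq0 -(f4 E) -H; apply/eqP; zmodule.
- have := key _ _ Ev (upperN pv uv) uu; rewrite Jv => H.
  by rewrite -[f (- v) u]H; zmodule.
- have := key _ _ Euv (upperN pu uu) (upperN pv uv); rewrite Ju Jv => H.
  by rewrite -H; zmodule.
Qed.
End Potential.

(** The hypotheses say that f sums to zero around the triangles u, u + v, v and the squares u, v,
    -u, -v, and these generate all cycles in the graph of oriented bases. *)
Lemma potential_exists (B : zmodType) (f : vec -> vec -> B) :
  (forall u v, det2 u v = 1 -> f u v = f u (u + v) + f (u + v) v) ->
  (forall u v, det2 u v = 1 -> f u v + f v (- u) + f (- u) (- v) + f (- v) u = 0) ->
  exists F : vec -> B, forall u v, det2 u v = 1 -> F v - F u = f u v.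
Proof. by move=> f3 f4; exists (pot f) => u v; apply: pot_edge. Qed.

Definition edge (u v : vec) := det2 u v == 1.
Definition in_cone p q w := (0 <= det2 p w) && (0 <= det2 w q).

(** Unimodular subdivision of a cone: w completes p and is reduced so that det2 w q is a remainder
    modulo det2 p q, nonzero because w and q are primitive and det2 p q is not 1. Staying in the
    cone later keeps exponents nonnegative. *)
Lemma cone_path p q : prim p -> prim q -> 0 < det2 p q ->
  exists s, [/\ path edge p s, last p s = q & all (in_cone p q) (p :: s)].
Proof.
have [n] := ubnP `|det2 p q|%N; elim: n p => // n IH p lt pp pq pos.
have [d1|d1] := eqVneq (det2 p q) 1.
  by exists [:: q]; rewrite /= /edge /in_cone d1 !det2vv eqxx.
have : det2 p (nbout p) = 1 by apply: det2_nbout.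
move: (nbout p) => w0 E0.
pose w := w0 - vscale (det2 w0 q %/ det2 p q)%Z p.
have Ew : det2 p w = 1 by rewrite /w !det2E E0 mulr0 subr0.
have dn : det2 p q != 0 by lia.
have Ewq : det2 w q = (det2 w0 q %% det2 p q)%Z.
  by rewrite /w !det2E {1}(divz_eq (det2 w0 q) (det2 p q)); ring.
have ge := modz_ge0 (det2 w0 q) dn.
have lt2 : (det2 w0 q %% det2 p q)%Z < det2 p q by apply: ltz_pmod.
have pos2 : 0 < det2 w q.
  rewrite Ewq lt_neqAle ge andbT; apply/eqP; rewrite -Ewq => Z.
  have := plucker p q w (nbout q); rewrite Ew (det2_nbout pq) (det2C w q) -Z oppr0 mulr0 addr0.
  by move/eqP; rewrite mulr1 subr_eq0 => /eqP /intM1; move: d1 pos; lia.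
have ltw : (`|det2 w q| < n)%N by rewrite Ewq; move: lt ge lt2; lia.
have [s [ps ls cs]] := IH w ltw (det2_prim Ew).2 pq pos2.
exists (w :: s); split=> //=; first by rewrite /edge Ew eqxx.
rewrite {1 2}/in_cone det2vv lexx Ew (ltW pos) (ltW pos2) /=.
apply/allP => x xs; have /allP/(_ x) : all (in_cone w q) s by case/andP: cs.
rewrite xs => /(_ isT) /andP[c1 c2]; rewrite /in_cone c2 andbT.
have := plucker p q w x; rewrite Ew (det2C w q) (det2C x q) => H.
by nia.
Qed.

Lemma telescope (B : zmodType) (C : pred vec) (E : vec -> vec -> B) (F : vec -> B) p s :
  path edge p s -> all C (p :: s) ->
  (forall u v, det2 u v = 1 -> C u -> C v -> E u v = F v - F u) ->
  \sum_(e <- zip (p :: s) s) E e.1 e.2 = F (last p s) - F p.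
Proof.
move=> + + H; elim: s p => [|q s IH] p /=; first by rewrite big_nil subrr.
case/andP=> /eqP pq ps /and3P[Cp Cq Cs]; rewrite big_cons /= H // IH //=; first by zmodule.
by rewrite Cq.
Qed.

(** Cone paths connect independent primitive vectors; equal or opposite ones are joined through a
    common neighbour. *)
Lemma potential_unique (B : zmodType) (F1 F2 : vec -> B) :
  (forall u v, det2 u v = 1 -> F1 v - F1 u = F2 v - F2 u) ->
  forall p q, prim p -> prim q -> F1 q - F1 p = F2 q - F2 p.
Proof.
move=> H.
have pos p q : prim p -> prim q -> 0 < det2 p q -> F1 q - F1 p = F2 q - F2 p.
  move=> pp pq dpq; have [s [ps <- cs]] := cone_path pp pq dpq.
  have T F := @telescope _ xpredT (fun u v => F1 v - F1 u) F p s ps (all_predT _).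
  by rewrite -(T F1) // -(T F2) // => u v /H.
move=> p q pp pq; have [lt|gt|d0] := ltgtP 0 (det2 p q).
- exact: pos.
- by rewrite -opprB pos // ?opprB // det2C oppr_gt0.
have Ew := det2_nbout pp; move: (nbout p) Ew => w Ew.
have := plucker p w q (nbout q); rewrite Ew -d0 det2_nbout // mul0r subr0 mulr1 => E.
have /intM1[[_ Ewq]|[_ Ewq]] : det2 p (nbout q) * det2 q w = 1.
  by rewrite (det2C w) -[LHS]addr0 -E; ring.
  have H1 := H _ _ Ewq; have H2 := H _ _ Ew.
  by transitivity ((F1 w - F1 p) - (F1 w - F1 q)); [zmodule|rewrite H1 H2; zmodule].
have Ew' : det2 w q = 1 by rewrite det2C Ewq opprK.
have H1 := H _ _ Ew'; have H2 := H _ _ Ew.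
by transitivity ((F1 q - F1 w) + (F1 w - F1 p)); [zmodule|rewrite H1 H2; zmodule].
Qed.

(* A sum over the edges of a path that receives h q (- p) for entering and - h p q for leaving a
   bad vertex telescopes: h w depends on its second argument only modulo w. *)
Section Pole.
Variables (B : zmodType) (bad : pred vec) (h : vec -> vec -> B).
Hypothesis h_inv : forall w q, bad w -> det2 w q = 1 -> h w q = h w (q + w).
Definition pole w : B := if bad w then h w (nbout w) else 0.

Lemma poleE p q : det2 p q = 1 ->
  pole q - pole p = (if bad q then h q (- p) else 0) - (if bad p then h p q else 0).
Proof.
move=> E; have [pp pq] := det2_prim E; rewrite /pole.
congr (_ - _); case: ifP => // b; apply: (@shift_inv _ (h _) _ (fun w => @h_inv _ w b)) => //.
- exact: det2_nbout.
- by rewrite det2Nr det2C opprK.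
- exact: det2_nbout.
Qed.
End Pole.

(** * Symbols attached to the edges of a sublattice *)

Lemma stXzr (L : fieldType) (B : zmodType) (S : L -> L -> B) a b (n : int) :
  steinberg S -> a != 0 -> b != 0 -> S a (b ^ n) = S a b *~ n.
Proof.
move=> SP a0 b0; case: n => n; first by rewrite -exprnP -pmulrn (stXr SP).
rewrite NegzE -invr_expz mulrNz -pmulrn -(stXr SP) //; apply/eqP.
by rewrite -addr_eq0 -(stMr SP) ?invr_eq0 ?expf_neq0 // mulVf ?expf_neq0 // (st1r SP).
Qed.

Section RootOfUnity.
Variables (N : nat) (L : fieldType) (z : L).
Hypothesis hz : N.-primitive_root z.

Lemma z_neq0 : z != 0.
Proof. apply/eqP => E; have := prim_expr_order hz.
by rewrite E expr0n (gtn_eqF (prim_order_gt0 hz)) => /esym/eqP; rewrite oner_eq0. Qed.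
Lemma zX_neq0 (a : int) : z ^ a != 0. Proof. by rewrite expfz_neq0 ?z_neq0. Qed.
Lemma zX_eq1 (a : int) : (z ^ a == 1) = (N%:Z %| a)%Z.
Proof.
case: a => n; first by rewrite -exprnP -(prim_order_dvd hz) dvdzE.
by rewrite NegzE -invr_expz invr_eq1 -exprnP -(prim_order_dvd hz) dvdzE.
Qed.
Lemma zX_mod (a b : int) : (N%:Z %| a - b)%Z -> z ^ a = z ^ b.
Proof.
rewrite -zX_eq1 expfzDr ?z_neq0 // -invr_expz => /eqP E.
by rewrite -[LHS]mulr1 -(mulVf (zX_neq0 b)) mulrA E mul1r.
Qed.
Lemma sub1zX_neq0 (a : int) : ~~ (N%:Z %| a)%Z -> 1 - z ^ a != 0.
Proof. by rewrite -zX_eq1 subr_eq0 eq_sym. Qed.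

Variables (B : zmodType) (S : L -> L -> B).
Hypothesis SP : steinberg S.

(* The symbol of an edge joining vectors with second coordinates a and b.  When N divides one of
   them, 1 - z ^ 0 = 0 has no symbol; the values chosen keep the three-term relation true. *)
Definition edge_val (a b : int) : B :=
  if (N%:Z %| b)%Z then 0
  else if (N%:Z %| a)%Z then S (1 - z ^ b) (-1) else S (1 - z ^ b) (1 - z ^ (- a)).

Lemma edge_val_mod a a' b b' : (N%:Z %| a - a')%Z -> (N%:Z %| b - b')%Z -> edge_val a b = edge_val a' b'.
Proof.
move=> Ha Hb; rewrite /edge_val (zX_mod Hb) (@zX_mod (- a) (- a')); last first.
  by rewrite -opprD rpredN.
have E (c c' : int) : (N%:Z %| c - c')%Z -> (N%:Z %| c)%Z = (N%:Z %| c')%Z.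
  by move=> H; rewrite -[c](subrK c') rpredDl.
by rewrite (E _ _ Ha) (E _ _ Hb).
Qed.

(** Since m is invertible modulo N, z^d is a power of w = z^(m d), and {1 - w, w} = 0. *)
Lemma sub1_coprime (m d : int) : coprimez m N%:Z -> ~~ (N%:Z %| d)%Z ->
  S (1 - z ^ (m * d)) (z ^ d) = 0.
Proof.
move=> /coprimezP[[a b] /= E] Nd.
have Nmd : ~~ (N%:Z %| m * d)%Z by rewrite Gauss_dvdzr // coprimez_sym; apply/coprimezP; exists (a, b).
have -> : z ^ d = (z ^ (m * d)) ^ a.
  rewrite exprz_exp; apply: zX_mod; have -> : d - m * d * a = b * d * N%:Z.
    by transitivity ((a * m + b * N%:Z) * d - m * d * a); [rewrite E mul1r|ring].
  exact: dvdz_mull.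
have c0 := sub1zX_neq0 Nmd; rewrite (stXzr _ SP) ?zX_neq0 //.
by rewrite (st_anti SP) ?zX_neq0 // (st_sub1 SP) ?zX_neq0 // oppr0 mul0rz.
Qed.
End RootOfUnity.

(** * Polynomial lifts of edge symbols, their residues and specializations *)

Section Edges.
Variables (L : fieldType) (y : L).
Definition mono (w : vec) : {poly L} := 1 - (y ^ w.2)%:P * 'X^(absz w.1).
(* The symbol {1 - z^q, 1 - z^(-p)}, where mono w is 1 - z^w (for w.1 >= 0), expanded by
   1 - z^(-p) = - z^(-p) (1 - z^p) so that only polynomials occur. *)
Definition edge_sum (p q : vec) : psum L :=
  [:: (1, (mono q, mono p)); (1, (mono q, (- y ^ (- p.2))%:P)); (- p.1, (mono q, 'X))].

Lemma edge_sumE (B : zmodType) (c : {poly L} -> {poly L} -> B) p q :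
  feval c (edge_sum p q) =
  c (mono q) (mono p) + c (mono q) (- y ^ (- p.2))%:P - c (mono q) 'X *~ p.1.
Proof. by rewrite /edge_sum !feval_cons feval_nil /= addr0 !mulr1z mulrNz addrA. Qed.

Variables (K : fieldType) (io : {rmorphism L -> K}) (tau : K).
Hypothesis y0 : y != 0.

Definition mval (w : vec) : K := io y ^ w.2 * tau ^ w.1.

Lemma mono_horner w : 0 <= w.1 -> (map_poly io (mono w)).[tau] = 1 - mval w.
Proof.
case: w => [[n|//] b] _; rewrite /mono /mval rmorphB rmorph1 rmorphM /= map_polyC /=.
by rewrite map_polyXn !hornerE fmorphXz.
Qed.
Lemma mono_deriv w : 0 < w.1 ->
  (map_poly io (mono w))^`().[tau] = - (io y ^ w.2 * tau ^ (w.1 - 1) * w.1%:~R).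
Proof.
case: w => [[[//|n]|//] b] _; rewrite /mono /=.
have -> : map_poly io (1 - (y ^ b)%:P * 'X^(n.+1)) = 1%:P - (io y ^ b)%:P * 'X^(n.+1).
  by rewrite rmorphB rmorph1 rmorphM /= map_polyC /= map_polyXn fmorphXz.
rewrite derivB derivC sub0r derivM derivC mul0r add0r derivXn.
rewrite hornerN hornerM hornerC hornerMn hornerXn /= -mulr_natr mulrA.
by have -> : n.+1%:Z - 1 = n by rewrite -addn1 PoszD addrK.
Qed.
Lemma ioy0 : io y != 0. Proof. by rewrite fmorph_eq0. Qed.
Lemma mvalD v w : tau != 0 -> mval (v + w) = mval v * mval w.
Proof. by move=> t0; rewrite /mval !vE !expfzDr ?ioy0 // mulrACA. Qed.
Lemma mvalN w : tau != 0 -> mval (- w) = (mval w)^-1.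
Proof. by move=> t0; rewrite /mval !vE -!invr_expz invfM. Qed.
Definition bad (w : vec) := (0 < w.1) && (mval w == 1).

Lemma poly_const a : (map_poly io a%:P).[tau] = io a.
Proof. by rewrite map_polyC hornerC. Qed.
Lemma poly_X : (map_poly io 'X).[tau] = tau.
Proof. by rewrite map_polyX hornerX. Qed.

(** p.1 q - q.1 p = (0, det2 p q), so if z^p and z^q both took the value 1 at tau, then y^(det2 p q)
    would be 1. *)
Lemma not_both_bad p q : tau != 0 -> y ^ det2 p q != 1 -> bad p -> ~~ bad q.
Proof.
move=> t0 yd /andP[_ /eqP Ep]; apply/negP => /andP[_ /eqP Eq]; move/negP: yd; apply.
rewrite -(fmorph_eq1 io) fmorphXz.
have X (w : vec) n : mval w = 1 -> mval (vscale n w) = 1.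
  have -> : mval (vscale n w) = mval w ^ n.
    by rewrite /mval !vE expfzMl !exprz_exp; congr (_ ^ _ * _ ^ _); ring.
  by move=> ->; rewrite exp1rz.
have := mvalD (vscale p.1 q) (- vscale q.1 p) t0; rewrite mvalN // !X // invr1 mulr1 => <-.
by rewrite /mval !vE [_ + _ in X in tau ^ X]addrC mulrC (_ : _ + _ = 0) ?mul1r;
   rewrite ?/det2; [apply/eqP; congr (_ ^ _); ring|ring].
Qed.
End Edges.

Section EdgeEval.
Variables (N : nat) (L : fieldType) (z : L).
Hypothesis hz : N.-primitive_root z.
Hypothesis L0 : forall n, n.+1%:R != 0 :> L.
Variable dv : int.
Hypothesis Ndv : ~~ (N%:Z %| dv)%Z.
Let y := z ^ dv.

Record edge_ok (p q : vec) : Prop := EdgeOk {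
  eo_p1 : 0 <= p.1; eo_p2 : 0 <= p.2; eo_q1 : 0 <= q.1; eo_q2 : 0 <= q.2;
  eo_pos : 0 < det2 p q; eo_cop : coprimez (det2 p q) N%:Z }.

Lemma y_neq0 : y != 0. Proof. exact: (zX_neq0 hz). Qed.
Lemma yX_neq1 m : coprimez m N%:Z -> y ^ m != 1.
Proof. by move=> c; rewrite /y exprz_exp (zX_eq1 hz) Gauss_dvdzl // coprimez_sym. Qed.
Lemma edge_src p q : edge_ok p q -> 0 < p.1.
Proof. by case=> p1 p2 q1 q2; rewrite /det2 => pos _; rewrite lt_neqAle p1 andbT; apply/eqP; nia. Qed.
Lemma edge_tgt p q : edge_ok p q -> q.1 = 0 -> coprimez q.2 N%:Z.
Proof.
case=> p1 p2 q1 q2; rewrite /det2 => pos c E; move: c; rewrite E mul0r subr0.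
by rewrite coprimezMl => /andP[].
Qed.

Section AtPlace.
Variables (K : fieldType) (io : {rmorphism L -> K}) (tau : K).

Lemma mono_unit w : 0 <= w.1 -> (w.1 = 0 -> coprimez w.2 N%:Z) -> ~~ bad y io tau w ->
  (map_poly io (mono y w)).[tau] != 0.
Proof.
move=> w1 c; rewrite /bad mono_horner // subr_eq0 eq_sym.
have [E _|ne] := eqVneq w.1 0; last by rewrite lt_neqAle eq_sym ne w1.
by rewrite eq_sym /mval E expr0z mulr1 -fmorphXz fmorph_eq1 yX_neq1 // c.
Qed.
Lemma mono_neq0 w : 0 <= w.1 -> (w.1 = 0 -> coprimez w.2 N%:Z) -> mono y w != 0.
Proof.
move=> w1 c; apply/negP => /eqP E; have [E1|ne] := eqVneq w.1 0.
  have := yX_neq1 (c E1); move: E; rewrite /mono E1 expr0 mulr1 -polyC1 -polyCB => /eqP.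
  by rewrite polyC_eq0 subr_eq0 eq_sym => ->.
have /(congr1 (fun p : {poly L} => p.[0])) := E; rewrite /mono !hornerE.
rewrite (_ : 0 ^+ _ = 0) ?mulr0 ?subr0; first by move/eqP; rewrite oner_eq0.
by rewrite expr0n; case: eqP => // /eqP; rewrite absz_eq0 (negPf ne).
Qed.
Lemma edge_nz p q : edge_ok p q ->
  all (fun t : int * ({poly L} * {poly L}) => (t.2.1 != 0) && (t.2.2 != 0)) (edge_sum y p q).
Proof.
move=> e; have sp := edge_src e; have tq := edge_tgt e; case: e => p1 p2 q1 q2 _ _.
rewrite /edge_sum /= !mono_neq0 //; last by move=> E; move: sp; rewrite E.
by rewrite polyC_eq0 oppr_eq0 expfz_neq0 ?y_neq0 // polyX_eq0.
Qed.

Lemma const_unit a : a != 0 -> pv io tau a%:P = 0%N /\ plc io tau a%:P = io a.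
Proof. by move=> a0; have := @place_unit _ _ io tau a%:P; rewrite poly_const fmorph_eq0; apply. Qed.
Lemma X_unit : tau != 0 -> pv io tau 'X = 0%N /\ plc io tau 'X = tau.
Proof. by have := @place_unit _ _ io tau 'X; rewrite poly_X. Qed.
Lemma cst_neq0 (w : vec) : - y ^ (- w.2) != 0.
Proof. by rewrite oppr_eq0 expfz_neq0 ?y_neq0. Qed.
Lemma mono_unitE w : 0 <= w.1 -> (w.1 = 0 -> coprimez w.2 N%:Z) -> ~~ bad y io tau w ->
  pv io tau (mono y w) = 0%N /\ plc io tau (mono y w) = 1 - mval y io tau w.
Proof. by move=> w1 c nb; have := place_unit (mono_unit w1 c nb); rewrite mono_horner. Qed.
Lemma mono_badE w : tau != 0 -> bad y io tau w ->
  pv io tau (mono y w) = 1%N /\ plc io tau (mono y w) = - (w.1%:~R / tau).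
Proof.
move=> t0 /andP[w1 /eqP bw].
have H1 : (map_poly io (mono y w)).[tau] = 0 by rewrite mono_horner ?ltW // bw subrr.
have w0 : (w.1)%:~R != 0 :> K.
  have -> : w.1 = (`|w.1|%N.-1.+1)%:Z by lia.
  by rewrite -pmulrn -(rmorph_nat io) fmorph_eq0 L0.
have E : (map_poly io (mono y w))^`().[tau] = - (w.1%:~R / tau).
  by rewrite mono_deriv // expfzDr // mulrA -/(mval y io tau w) bw mul1r mulrC.
rewrite -E; apply: place_simple => //.
by rewrite E oppr_eq0 mulf_neq0 // invr_eq0.
Qed.
Lemma sub1_mvalN p : tau != 0 ->
  1 - mval y io tau (- p) = (1 - mval y io tau p) * (- io y ^ (- p.2)) * tau ^ (- p.1).
Proof.
move=> t0; rewrite /mval !vE -!invr_expz; field.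
by rewrite !expfz_neq0 ?ioy0 ?y_neq0.
Qed.

Definition tameh (w q : vec) : mulgrp K := - mk (1 - mval y io tau q).

Lemma tameh_inv w q : tau != 0 -> bad y io tau w -> tameh w q = tameh w (q + w).
Proof.
move=> t0 /andP[_ /eqP E]; by rewrite /tameh mvalD ?y_neq0 // E mulr1.
Qed.

(** At most one of the two ends vanishes at tau, and to first order since the characteristic is 0;
    the residue is, up to inversion, the value of the other entry of the symbol, in the form that
    [poleE] telescopes. *)
Lemma edge_tame p q : tau != 0 -> edge_ok p q ->
  feval (tame (pv io tau) (plc io tau)) (edge_sum y p q) =
  (if bad y io tau q then tameh q (- p) else 0) - (if bad y io tau p then tameh p q else 0).
Proof.
move=> t0 e; have sp := edge_src e; have tq := edge_tgt e.
have yd := yX_neq1 (eo_cop e); case: e => p1 p2 q1 q2 pos cop.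
have nbb : bad y io tau p -> ~~ bad y io tau q by apply: not_both_bad; rewrite ?y_neq0.
have tp : p.1 = 0 -> coprimez p.2 N%:Z by move=> E; move: sp; rewrite E.
rewrite edge_sumE; have [vc lc] := const_unit (cst_neq0 p); have [vX lX] := X_unit t0.
have {}lc : plc io tau (- y ^ (- p.2))%:P = - io y ^ (- p.2) by rewrite lc rmorphN fmorphXz.
rewrite /tame vc lc vX lX; case: ifP => bq; case: ifP => bp.
- by move: (nbb bp); rewrite bq.
- have [-> ->] := mono_unitE p1 tp (negbT bp); have [-> _] := mono_badE t0 bq.
  rewrite !muln0 !mulr0n !mulr1n !add0r subr0 /tameh sub1_mvalN //.
  have h0 : 1 - mval y io tau p != 0 by rewrite -mono_horner //; exact: mono_unit (negbT bp).
  have c0 : - io y ^ (- p.2) != 0 by rewrite oppr_eq0 expfz_neq0 ?ioy0 ?y_neq0.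
  have X0 : tau ^ (- p.1) != 0 by rewrite expfz_neq0.
  rewrite !mkM ?mulf_neq0 // -[tau ^ (- p.1)]invr_expz mkV ?expfz_neq0 //.
  have -> : mk (tau ^ p.1) = mk tau *~ p.1.
    by move: p1; case: (p.1) => // n _; rewrite -exprnP mkX.
  by rewrite mulNrz; zmodule.
- have [-> ->] := mono_unitE q1 tq (negbT bq); have [-> _] := mono_badE t0 bp.
  by rewrite /= !mulr0n mulr1n !oppr0 !addr0 mul0rz /tameh; zmodule.
- have [-> ->] := mono_unitE q1 tq (negbT bq); have [-> ->] := mono_unitE p1 tp (negbT bp).
  by rewrite /= !mulr0n !oppr0 !addr0 mul0rz oppr0 addr0.
Qed.

(** Residue at t = 0, where only the factor X contributes. For an edge from p to w = (0, w.2) its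
    multiplicity p.1 equals det2 p w / w.2, so the residue depends on w and the determinant D alone
    and telescopes along a path with constant D. *)
Definition tame0 (D : int) (w : vec) : mulgrp K :=
  if w.1 == 0 then - mk (1 - io y ^ w.2) *~ (D %/ w.2)%Z else 0.
End AtPlace.

Section AtZero.
Variables (K : fieldType) (io : {rmorphism L -> K}).

Lemma X_zero : pv io 0 'X = 1%N /\ plc io 0 'X = 1.
Proof.
by have := @place_simple _ _ io 0 'X; rewrite poly_X map_polyX derivX hornerC; apply=> //;
   exact: oner_neq0.
Qed.
Lemma mono_zero w : 0 <= w.1 -> (w.1 = 0 -> coprimez w.2 N%:Z) ->
  pv io 0 (mono y w) = 0%N /\ plc io 0 (mono y w) = if w.1 == 0 then 1 - io y ^ w.2 else 1.
Proof.
move=> w1 c; have nb : ~~ bad y io 0 w.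
  by apply/negP => /andP[lt]; rewrite /mval exp0rz (gt_eqF lt) mulr0 eq_sym oner_eq0.
have [-> ->] := mono_unitE w1 c nb; rewrite /mval exp0rz.
by case: eqP => _; rewrite ?mulr1 ?mulr0 ?subr0.
Qed.

Lemma edge_tame0 p q : edge_ok p q ->
  feval (tame (pv io 0) (plc io 0)) (edge_sum y p q) =
  tame0 io (det2 p q) q - tame0 io (det2 p q) p.
Proof.
move=> e; have sp := edge_src e; have tq := edge_tgt e; case: e => p1 p2 q1 q2 pos cop.
have tp : p.1 = 0 -> coprimez p.2 N%:Z by move=> E; move: sp; rewrite E.
rewrite edge_sumE; have [vc lc] := const_unit io 0 (cst_neq0 p).
rewrite /tame vc lc (X_zero).1 (X_zero).2.
have [-> ->] := mono_zero q1 tq; have [-> ->] := mono_zero p1 tp.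
rewrite !mul0n !mulr0n mulr1n !add0r !subr0 ?add0r /tame0 (gt_eqF sp).
case: eqP => [E|_]; last by rewrite mk1 mul0rz !oppr0 addr0.
rewrite !oppr0 add0r addr0 mulNrz; congr (- (_ *~ _)).
have q20 : q.2 != 0 by apply: contraTneq pos => E2; rewrite /det2 E E2 mulr0 mul0r subr0 ltxx.
by rewrite /det2 E mul0r subr0 mulzK.
Qed.
End AtZero.

Section Specialize.
Variables (B : zmodType) (S : L -> L -> B).
Hypothesis SP : steinberg S.
Variable du : int.
Let x := z ^ du.
Local Notation id_ := (idfun : {rmorphism L -> L}).
Definition level (w : vec) : int := w.1 * du + w.2 * dv.

Lemma mval_level w : mval y id_ x w = z ^ level w.
Proof.
rewrite /mval /level /= /y /x !exprz_exp -expfzDr ?(z_neq0 hz) //.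
by congr (_ ^ _); ring.
Qed.

Definition spech (w q : vec) : B := S (- (w.1%:~R / x)) (1 - mval y id_ x q).

Lemma x_neq0 : x != 0. Proof. exact: (zX_neq0 hz). Qed.
Lemma spech_inv w q : bad y id_ x w -> spech w q = spech w (q + w).
Proof. by move=> /andP[_ /eqP E]; rewrite /spech mvalD ?y_neq0 ?x_neq0 // E mulr1. Qed.

(** At t = x the factors 1 - z^w take the values 1 - z^(level w). Where one vanishes, the leading
    coefficient - w.1 / x takes its place, and the error with respect to [edge_val] is again of
    [pole] form. *)
Lemma edge_spec p q : edge_ok p q ->
  feval (fun f g => S (plc id_ x f) (plc id_ x g)) (edge_sum y p q) =
  edge_val N z S (level p) (level q) +
  ((if bad y id_ x q then spech q (- p) else 0) - (if bad y id_ x p then spech p q else 0)).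
Proof.
move=> e; have sp := edge_src e; have tq := edge_tgt e.
have yd := yX_neq1 (eo_cop e); case: e => p1 p2 q1 q2 pos cop.
have x0 := x_neq0.
have nbb : bad y id_ x p -> ~~ bad y id_ x q by apply: not_both_bad; rewrite ?y_neq0.
have tp : p.1 = 0 -> coprimez p.2 N%:Z by move=> E; move: sp; rewrite E.
have badN w : bad y id_ x w -> (N%:Z %| level w)%Z.
  by move=> /andP[_]; rewrite mval_level (zX_eq1 hz).
have goodN w : 0 <= w.1 -> (w.1 = 0 -> coprimez w.2 N%:Z) -> ~~ bad y id_ x w ->
    1 - z ^ level w != 0 /\ ~~ (N%:Z %| level w)%Z.
  move=> w1 c nb; have := mono_unit w1 c nb; rewrite mono_horner // mval_level => H.
  by split=> //; rewrite -(zX_eq1 hz) eq_sym -subr_eq0.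
rewrite edge_sumE; have [_ ->] := const_unit id_ x (cst_neq0 p); have [_ ->] := X_unit id_ x0.
set lq := plc _ _ (mono y q); set lp := plc _ _ (mono y p).
have lq0 : lq != 0 by apply: (lc_neq0 (place_leading id_ x)); exact: mono_neq0.
have lp0 : lp != 0 by apply: (lc_neq0 (place_leading id_ x)); exact: mono_neq0.
have -> : S lq lp + S lq (id_ (- y ^ (- p.2))) - S lq x *~ p.1 =
    S lq (lp * (- y ^ (- p.2)) * x ^ (- p.1)).
  have c0 := cst_neq0 p; have X0 : x ^ (- p.1) != 0 by rewrite expfz_neq0.
  rewrite (stMr SP lq0 (mulf_neq0 lp0 c0) X0) (stMr SP lq0 lp0 c0).
  by rewrite (stXzr _ SP lq0 x0) mulrNz.
have EN := sub1_mvalN id_ p x0; rewrite /= in EN.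
rewrite /edge_val; have [bq|bq] := boolP (bad y id_ x q); have [bp|bp] := boolP (bad y id_ x p).
- by move: (nbb bp); rewrite bq.
- by rewrite /lp /lq (mono_unitE p1 tp bp).2 (mono_badE x0 bq).2 badN // add0r subr0 /spech -EN.
- have [q0 nq] := goodN q q1 tq bq; rewrite (negPf nq) badN //.
  have -> : lq = 1 - z ^ level q by rewrite /lq (mono_unitE q1 tq bq).2 mval_level.
  have -> : lp * - y ^ (- p.2) * x ^ (- p.1) = lp * -1.
    rewrite -mulrA; congr (_ * _); rewrite mulNr -!invr_expz -invfM.
    by have /andP[_ /eqP] := bp; rewrite /mval /= => ->; rewrite invr1.
  rewrite (stMr SP) ?oppr_eq0 ?oner_neq0 // /spech mval_level.
  rewrite (st_anti SP q0 lp0) /lp (mono_badE x0 bp).2; zmodule.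
have [q0 nq] := goodN q q1 tq bq; have [p0 np] := goodN p p1 tp bp.
rewrite (negPf nq) (negPf np) subr0 addr0.
have -> : lq = 1 - z ^ level q by rewrite /lq (mono_unitE q1 tq bq).2 mval_level.
congr (S _ _); rewrite /lp (mono_unitE p1 tp bp).2 -EN mval_level.
by congr (_ - _ ^ _); rewrite /level !vE; ring.
Qed.

Definition spec0 (w : vec) : B := if w.1 == 0 then S (1 - y ^ w.2) (-1) else 0.

(** Monomials with a positive power of t disappear, which leaves {1 - y^q.2, - y^(- p.2)} if q.1 =
    0; [sub1_coprime] removes the power of y. *)
Lemma edge_spec0 p q : edge_ok p q ->
  feval (fun f g => S (plc id_ 0 f) (plc id_ 0 g)) (edge_sum y p q) = spec0 q - spec0 p.
Proof.
move=> e; have sp := edge_src e; have tq := edge_tgt e; case: e => p1 p2 q1 q2 pos cop.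
have tp : p.1 = 0 -> coprimez p.2 N%:Z by move=> E; move: sp; rewrite E.
rewrite edge_sumE; have [_ ->] := const_unit id_ 0 (cst_neq0 p).
have [_ ->] := mono_zero id_ q1 tq; have [_ ->] := mono_zero id_ p1 tp.
rewrite (X_zero id_).2 (gt_eqF sp) /spec0 (gt_eqF sp) subr0 /=.
have c0 := cst_neq0 p; case: eqP => [E|_]; last first.
  by rewrite !(st1l SP) ?oner_neq0 // mul0rz subr0 addr0.
have l0 : 1 - y ^ q.2 != 0 by rewrite subr_eq0 eq_sym yX_neq1 // tq.
rewrite !(st1r SP) // mul0rz subr0 add0r -[- y ^ (- p.2)]mulN1r.
rewrite (stMr SP) ?oppr_eq0 ?oner_neq0 ?expfz_neq0 ?(z_neq0 hz) //.
rewrite (stXzr _ SP) ?y_neq0 ?(z_neq0 hz) // [S _ y](_ : _ = 0) ?mul0rz ?addr0 //.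
by rewrite /y exprz_exp mulrC (sub1_coprime hz) ?tq ?(z_neq0 hz).
Qed.
End Specialize.
End EdgeEval.

(** * The sum over the sublattices of prime index *)

Definition psum_scale (L : fieldType) (n : int) (D : psum L) : psum L :=
  [seq (n * t.1, t.2) | t <- D].
Lemma feval_scale (L : fieldType) (B : zmodType) (c : {poly L} -> {poly L} -> B) n (D : psum L) :
  feval c (psum_scale n D) = feval c D *~ n.
Proof.
by rewrite /feval big_map mulrz_suml; apply: eq_bigr => t _; rewrite mulrC mulrzA.
Qed.

Lemma sum_one_special (B : zmodType) n (i0 : 'I_n.+1) (a b : B) (P : pred 'I_n.+1) :
  P =1 pred1 i0 -> \sum_i (if P i then a else b) = a + b *+ n.
Proof.
move=> E; rewrite (bigD1 i0) //= E /= eqxx; congr (_ + _).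
rewrite (eq_bigr (fun=> b)) => [|i /negPf ne]; last by rewrite E /= ne.
by rewrite sumr_const (cardC1 i0) card_ord.
Qed.

(** The k i form a complete residue system modulo n, and the product is Y^n times the factored X^n -
    1 evaluated at Y^-1. *)
Lemma prod_root_powers (K : fieldType) n (tau Y : K) (k : 'I_n -> int) :
  n.-primitive_root tau -> Y != 0 ->
  (forall i j, (n%:Z %| k i - k j)%Z -> i = j) ->
  \prod_i (1 - Y * tau ^ k i) = 1 - Y ^+ n.
Proof.
move=> ht Y0 kinj; have n0 := prim_order_gt0 ht.
have lt i : (absz (k i %% n%:Z)%Z < n)%N.
  have n1 : n%:Z != 0 by lia.
  have := modz_ge0 (k i) n1; have : (k i %% n%:Z)%Z < n%:Z by apply: ltz_pmod; lia.
  by lia.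
pose kk i : 'I_n := Ordinal (lt i).
have Ekk i : (kk i)%:Z = (k i %% n%:Z)%Z by rewrite /= gez0_abs // modz_ge0 //; lia.
have kk_inj : injective kk.
  move=> i j /(congr1 (fun a : 'I_n => (a : nat)%:Z)); rewrite !Ekk => /eqP.
  by rewrite eqz_mod_dvd => /kinj.
have Et i : tau ^ k i = tau ^+ kk i.
  by rewrite exprnP Ekk; apply: (zX_mod ht); rewrite -eqz_mod_dvd modz_mod.
rewrite (eq_bigr (fun i => 1 - Y * tau ^+ kk i)) => [|i _]; last by rewrite Et.
transitivity (\prod_(i < n) (1 - Y * tau ^+ i)); first by rewrite [RHS](reindex_inj kk_inj).
have := congr1 (fun p : {poly K} => p.[Y^-1]) (factor_Xn_sub_1 ht).
rewrite horner_prod !hornerE => E.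
transitivity (\prod_(0 <= i < n) (Y * (Y^-1 - tau ^+ i))).
  by rewrite big_mkord; apply: eq_bigr => i _; rewrite mulrBr divff.
rewrite big_split /= prodr_const_nat subn0.
have <- : \prod_(0 <= i < n) ('X - (tau ^+ i)%:P).[Y^-1] = \prod_(0 <= i < n) (Y^-1 - tau ^+ i).
  by apply: eq_bigr => i _; rewrite !hornerE.
by rewrite E exprVn mulrBr divff ?expf_neq0 // mulr1.
Qed.

Lemma path_edges (C : pred vec) p s (e : vec * vec) :
  path edge p s -> all C (p :: s) -> e \in zip (p :: s) s -> [/\ det2 e.1 e.2 = 1, C e.1 & C e.2].
Proof.
elim: s p => //= q s IH p /andP[/eqP pq ps] /and3P[Cp Cq Cs].
by rewrite inE => /orP[/eqP ->|] //; apply: IH => //=; rewrite Cq.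
Qed.

Lemma prime_root (K : fieldType) l (tau : K) :
  prime l -> tau ^+ l = 1 -> tau != 1 -> l.-primitive_root tau.
Proof.
move=> pl tl t1; have [m hm] := prim_order_exists (prime_gt0 pl) tl.
move=> /(primeP pl).2 /orP[/eqP m1|/eqP <- //].
by move: t1; rewrite -[tau]expr1 -m1 (prim_expr_order hm) eqxx.
Qed.

Section Family.
Variables (N : nat) (L : fieldType) (z : L).
Hypothesis hz : N.-primitive_root z.
Hypothesis L0 : forall n, n.+1%:R != 0 :> L.
Variables (du dv : int).
Hypotheses (Ndu : ~~ (N%:Z %| du)%Z) (Ndv : ~~ (N%:Z %| dv)%Z).
Variable l : nat.
Hypotheses (l_prime : prime l) (lN : coprime l N).
Let y := z ^ dv.
Let x := z ^ du.

(* A j is the embedding of the j-th sublattice of index l, in the coordinates given by a basis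
   (u, v) of Z^2; the primitive vectors of that sublattice on the axes are us j and vs j. *)
Variables (A : 'I_l.+1 -> vec -> vec) (us vs : 'I_l.+1 -> vec) (iu iv : 'I_l.+1).
Hypothesis AD : forall j p q, A j (p + q) = A j p + A j q.
Hypothesis AN : forall j p, A j (- p) = - A j p.
Hypothesis Adet : forall j p q, det2 (A j p) (A j q) = l%:Z * det2 p q.
Hypothesis us_prim : forall j, prim (us j).
Hypothesis vs_prim : forall j, prim (vs j).
Hypothesis A_us : forall j, A j (us j) = (if j == iu then 1 else l%:Z, 0).
Hypothesis A_vs : forall j, A j (vs j) = (0, if j == iv then 1 else l%:Z).
Hypothesis A_inj : forall i j p q, (A i p).2 = 1 -> (A j q).2 = 1 ->
  (l%:Z %| (A i p).1 - (A j q).1)%Z -> i = j.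

Let l_gt0 : 0 < l%:Z. Proof. by have := prime_gt0 l_prime; lia. Qed.

Lemma mult_coprime (b : bool) : coprimez (if b then 1 else l%:Z) N%:Z.
Proof. by case: b; rewrite coprimezE ?coprime1n. Qed.

Lemma usvs_pos j : 0 < det2 (us j) (vs j).
Proof.
have := Adet j (us j) (vs j); rewrite A_us A_vs /det2 /= mulr0 subr0.
by case: (j == iu); case: (j == iv); nia.
Qed.

Definition fpath j := projT1 (cid (cone_path (us_prim j) (vs_prim j) (usvs_pos j))).
Lemma fpathP j : [/\ path edge (us j) (fpath j), last (us j) (fpath j) = vs j &
  all (in_cone (us j) (vs j)) (us j :: fpath j)].
Proof. by rewrite /fpath; case: cid. Qed.

Lemma cone_quadrant j w : in_cone (us j) (vs j) w -> 0 <= (A j w).1 /\ 0 <= (A j w).2.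
Proof.
case/andP=> c1 c2.
have m0 (b : bool) : 0 < (if b then 1 else l%:Z) by case: b.
have E1 : (if j == iu then 1 else l%:Z) * (A j w).2 = l%:Z * det2 (us j) w.
  by rewrite -(Adet j) A_us /det2 /= mulr0 subr0.
have E2 : (if j == iv then 1 else l%:Z) * (A j w).1 = l%:Z * det2 w (vs j).
  by rewrite -(Adet j) A_vs /det2 /= mul0r subr0 mulrC.
by split; [rewrite -(pmulr_rge0 _ (m0 (j == iv))) E2|rewrite -(pmulr_rge0 _ (m0 (j == iu))) E1];
   rewrite pmulr_rge0.
Qed.

Lemma family_edge_ok j p q : det2 p q = 1 ->
  in_cone (us j) (vs j) p -> in_cone (us j) (vs j) q -> edge_ok N (A j p) (A j q).
Proof.
move=> E /cone_quadrant[p1 p2] /cone_quadrant[q1 q2].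
by split; rewrite // Adet E mulr1 // (mult_coprime false).
Qed.

Lemma e10_ok : edge_ok N (1, 0) (0, 1).
Proof. by split; rewrite // /det2 /= mulr0 subr0 mulr1 (mult_coprime true). Qed.
Lemma el0_ok : edge_ok N (l%:Z, 0) (0, l%:Z).
Proof.
split; rewrite // /det2 /= mulr0 subr0 ?mulr_gt0 //.
by rewrite coprimezMl (mult_coprime false).
Qed.

(** Lift to L(t) of H(v) - H(u) - l f(u, v) - sigma_l f(u, v), with t for z^u; as sigma_l multiplies
    exponents by l, the edge from (l, 0) to (0, l) lifts the last term. *)
Definition family_sum : psum L :=
  flatten [seq flatten [seq edge_sum y (A j e.1) (A j e.2) | e <- zip (us j :: fpath j) (fpath j)]
          | j <- index_enum 'I_l.+1]
  ++ psum_scale (- l%:Z) (edge_sum y (1, 0) (0, 1)) ++ psum_opp (edge_sum y (l%:Z, 0) (0, l%:Z)).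

(** Common scheme for four evaluations: tame symbols at 0 and away from 0, specializations at x and
    at 0. On the sublattice paths G is a difference of values of [Phi j], so only the path ends
    remain. *)
Lemma family_eval (B : zmodType) (c : {poly L} -> {poly L} -> B) (G : vec -> vec -> B)
    (Phi : 'I_l.+1 -> vec -> B) :
  (forall p q, edge_ok N p q -> feval c (edge_sum y p q) = G p q) ->
  (forall j p q, det2 p q = 1 -> edge_ok N (A j p) (A j q) ->
     G (A j p) (A j q) = Phi j q - Phi j p) ->
  feval c family_sum = \sum_j (Phi j (vs j) - Phi j (us j))
    - G (1, 0) (0, 1) *+ l - G (l%:Z, 0) (0, l%:Z).
Proof.
move=> H1 H2; rewrite /family_sum !feval_cat feval_scale feval_opp !H1; try exact: e10_ok; try exact: el0_ok.
rewrite mulrNz -pmulrn addrA; congr (_ - _ - _).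
rewrite feval_flatten; apply: eq_bigr => j _; rewrite feval_flatten.
have [ps ls cs] := fpathP j.
have := @telescope _ _ (fun p q => feval c (edge_sum y (A j p) (A j q))) (Phi j) _ _ ps cs.
rewrite ls; apply=> p q E cp cq.
by have ok := family_edge_ok E cp cq; rewrite /= H1 // H2.
Qed.

Lemma family_nz : all (fun t : int * ({poly L} * {poly L}) => (t.2.1 != 0) && (t.2.2 != 0)) family_sum.
Proof.
rewrite /family_sum !all_cat /psum_scale /psum_opp !all_map.
have nz p q : edge_ok N p q -> all (fun t : int * ({poly L} * {poly L}) =>
    (t.2.1 != 0) && (t.2.2 != 0)) (edge_sum y p q) by exact: edge_nz.
apply/and3P; split; [|exact: (nz _ _ e10_ok)|exact: (nz _ _ el0_ok)].
apply/allP => t /flatten_mapP[j _ /flatten_mapP[[p q] e tin]].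
have [ps _ cs] := fpathP j; have [E cp cq] := path_edges ps cs e.
exact: (allP (nz _ _ (family_edge_ok E cp cq))).
Qed.

(** The sublattice [iv] contributes 1 - y with multiplicity l and each of the l others 1 - y^l once,
    which matches the two subtracted terms. *)
Lemma family_tame0 (K : fieldType) (io : {rmorphism L -> K}) :
  feval (tame (pv io 0) (plc io 0)) family_sum = 0.
Proof.
rewrite (@family_eval _ _ (fun p q => tame0 z dv io (det2 p q) q - tame0 z dv io (det2 p q) p)
  (fun j w => tame0 z dv io l%:Z (A j w))) //; first last.
- by move=> j p q E _; rewrite Adet E mulr1.
- by move=> p q e; rewrite (edge_tame0 hz).
have E0 m D : 0 < m -> tame0 z dv io D (m, 0) = 0.
  by move=> m0; rewrite /tame0 /= gt_eqF.
rewrite (eq_bigr (fun j => if j == iv then - mk (1 - io y) *~ l%:Z else - mk (1 - io y ^ l%:Z))); last first.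
  move=> j _; rewrite A_us A_vs E0 ?subr0; last by case: (j == iu).
  rewrite /tame0 /= -/y; case: (j == iv); first by rewrite expr1z divz1.
  by rewrite divzz gt_eqF // mulr1z.
rewrite (sum_one_special _ (i0 := iv)) // !E0 // !subr0 /tame0 /= -/y.
rewrite expr1z divz1 /det2 /= mulr0 !subr0 mulr1 mulr1z mulzK ?gt_eqF // -!pmulrn.
by zmodule.
Qed.

(** After telescoping only the starting points (1, 0) and (l, 0) can be bad, so only l-th roots of
    unity tau matter. For tau = 1 the terms match one by one; for tau of order l the factors 1 - y
    tau^k of the l sublattices other than [iu] multiply to 1 - y^l. *)
Lemma family_tame (K : fieldType) (io : {rmorphism L -> K}) (tau : K) : tau != 0 ->
  feval (tame (pv io tau) (plc io tau)) family_sum = 0.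
Proof.
move=> t0; have y0 := y_neq0 hz dv.
pose bd j w := bad y io tau (A j w).
pose h j w q := tameh z dv io tau (A j w) (A j q).
rewrite (@family_eval _ _ (fun p q => (if bad y io tau q then tameh z dv io tau q (- p) else 0)
    - (if bad y io tau p then tameh z dv io tau p q else 0)) (fun j => pole (bd j) (h j))).
2: by move=> p q e; rewrite (edge_tame hz).
2: move=> j p q E _; rewrite poleE // /bd /h ?AN //.
2: by move=> w q' bw _; rewrite /h AD (tameh_inv hz).
(* The residue at a bad starting point is read off from a neighbour, whose second coordinate is
   forced by the determinant l. *)
pose q j := A j (nbout (us j)).
have q2 j : (q j).2 = if j == iu then l%:Z else 1.
  have := Adet j (us j) (nbout (us j)); rewrite det2_nbout // mulr1 A_us /det2 /= mulr0 subr0.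
  by rewrite /q; case: (j == iu); [rewrite mul1r|rewrite -[RHS]mulr1 => /mulfI -> //; rewrite gt_eqF].
have bus m : 0 < m -> bad y io tau (m, 0) = (tau ^ m == 1).
  by move=> m0; rewrite /bad /mval /= expr0z mul1r m0.
have bvs m : bad y io tau (0, m) = false by rewrite /bad ltxx.
rewrite (eq_bigr (fun j => if tau ^ (if j == iu then 1 else l%:Z) == 1
                    then mk (1 - io y ^ (q j).2 * tau ^ (q j).1) else 0)); last first.
  move=> j _; rewrite /pole /bd A_vs bvs A_us bus; last by case: (j == iu).
  by case: ifP => _; rewrite ?subr0 // sub0r /h /tameh opprK.
rewrite !bvs !bus // /tameh /mval /= !expr1z !expr0z !mulr1.
have [t1|t1] := eqVneq tau 1.
  rewrite t1 !exp1rz eqxx (eq_bigr (fun j => if j == iu then mk (1 - io y ^ l%:Z) else mk (1 - io y))).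
    by rewrite (sum_one_special _ (i0 := iu)) // !sub0r !opprK; zmodule.
  by move=> j _; rewrite !exp1rz eqxx mulr1 q2; case: (j == iu).
rewrite !sub0r oppr0 mul0rn subr0.
have [tl|tl] := eqVneq (tau ^ l%:Z) 1; last first.
  by rewrite !oppr0 addr0 big1 // => j _; case: (j == iu); rewrite ?expr1z ?(negPf t1) ?(negPf tl).
rewrite (bigD1_ord iu) //= eqxx expr1z (negPf t1) add0r opprK.
have ht : l.-primitive_root tau by apply: prime_root.
have nl (i : 'I_l) : (lift iu i == iu) = false by rewrite eq_sym (negPf (neq_lift _ _)).
(* Different sublattices give exponents different modulo l, so every power of tau occurs exactly
   once. *)
have k_inj (i j : 'I_l) : (l%:Z %| (q (lift iu i)).1 - (q (lift iu j)).1)%Z -> i = j.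
  move=> /A_inj H; apply: (@lift_inj _ iu); by apply: H; rewrite -/(q _) q2 nl.
have P := prod_root_powers ht (ioy0 io y0) k_inj.
have yl : io y ^ l%:Z != 1.
  by rewrite -fmorphXz fmorph_eq1 (yX_neq1 hz) // (mult_coprime false).
rewrite (eq_bigr (fun i => mk (1 - io y * tau ^ (q (lift iu i)).1))); last first.
  by move=> i _; rewrite q2 nl tl eqxx expr1z.
have nz i : 1 - io y * tau ^ (q (lift iu i)).1 != 0.
  apply: contraNneq yl => E0; have : 1 - io y ^+ l == 0.
    by rewrite -P; apply/prodf_eq0; exists i; rewrite ?E0.
  by rewrite subr_eq0 eq_sym.
by rewrite -mk_prod // P subrr.
Qed.

Lemma family_unramified : unramified family_sum.
Proof.
move=> K io tau; have [->|t0] := eqVneq tau 0; [exact: family_tame0|exact: family_tame].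
Qed.

Variables (B : zmodType) (S : L -> L -> B).
Hypothesis SP : steinberg S.
Variable Phi : 'I_l.+1 -> vec -> B.
Hypothesis PhiP : forall j p q, det2 p q = 1 ->
  Phi j q - Phi j p = edge_val N z S (level dv du (A j p)) (level dv du (A j q)).

(** Equality of the specializations at t = x and t = 0. At 0 the sublattice [iv] gives {1 - y, -1}
    and the l others {1 - y^l, -1}; subtracting l {1 - y, -1} and {1 - y^l, -1} leaves the factor l
    - 1. *)
Theorem family_identity :
  \sum_j (Phi j (vs j) - Phi j (us j)) =
  edge_val N z S du dv *+ l + edge_val N z S (l%:Z * du) (l%:Z * dv)
  + (S (1 - z ^ (l%:Z * dv)) (-1) - S (1 - z ^ dv) (-1)) *+ l.-1.
Proof.
have x0 := x_neq0 hz du.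
have Nl d : ~~ (N%:Z %| d)%Z -> ~~ (N%:Z %| l%:Z * d)%Z.
  by move=> Nd; rewrite Gauss_dvdzr // coprimez_sym (mult_coprime false).
have E : feval (fun f g => S (plc (idfun : {rmorphism L -> L}) x f) (plc idfun x g)) family_sum =
         feval (fun f g => S (plc (idfun : {rmorphism L -> L}) 0 f) (plc idfun 0 g)) family_sum.
  apply: unramified_eval => //.
  - exact/specialize_steinberg/SP/place_leading.
  - exact/specialize_steinberg/SP/place_leading.
  - move=> a b a0 b0; have C t c : c != 0 -> plc (idfun : {rmorphism L -> L}) t c%:P = c.
      by move=> c0; rewrite (const_unit _ _ c0).2.
    by rewrite !C.
  - exact: family_nz.
  - exact: family_unramified.
have E0 : feval (fun f g => S (plc (idfun : {rmorphism L -> L}) 0 f) (plc idfun 0 g)) family_sum =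
  (S (1 - z ^ (l%:Z * dv)) (-1) - S (1 - z ^ dv) (-1)) *+ l.-1.
  rewrite (@family_eval _ _ (fun p q => spec0 z dv S q - spec0 z dv S p)
    (fun j w => spec0 z dv S (A j w))) //; last by move=> p q e; rewrite (edge_spec0 hz).
  have F0 m : 0 < m -> spec0 z dv S (m, 0) = 0.
    by move=> m0; rewrite /spec0 /= gt_eqF.
  rewrite (eq_bigr (fun j => if j == iv then S (1 - y) (-1) else S (1 - y ^ l%:Z) (-1))); last first.
    move=> j _; rewrite A_us A_vs F0 ?subr0; last by case: (j == iu).
    by rewrite /spec0 /= -/y; case: (j == iv); rewrite ?expr1z.
  rewrite (sum_one_special _ (i0 := iv)) // !F0 // !subr0 /spec0 /= -/y expr1z /y exprz_exp mulrC.
  have -> : l = l.-1.+1 by rewrite prednK // prime_gt0.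
  by rewrite !mulrS /= mulrnBl; zmodule.
have E1 : feval (fun f g => S (plc (idfun : {rmorphism L -> L}) x f) (plc idfun x g)) family_sum =
  \sum_j (Phi j (vs j) - Phi j (us j)) - edge_val N z S du dv *+ l - edge_val N z S (l%:Z * du) (l%:Z * dv).
  pose bd j w := bad y (idfun : {rmorphism L -> L}) x (A j w).
  pose h j w q := spech z dv S du (A j w) (A j q).
  have bus m : 0 < m -> ~~ (N%:Z %| m * du)%Z -> bad y (idfun : {rmorphism L -> L}) x (m, 0) = false.
    move=> m0 H; rewrite /bad (mval_level hz) // m0 /=.
    by rewrite (zX_eq1 hz) /level /= mul0r addr0 (negPf H).
  have bvs m : bad y (idfun : {rmorphism L -> L}) x (0, m) = false by rewrite /bad ltxx.
  rewrite (@family_eval _ _ _ (fun j w => Phi j w + pole (bd j) (h j) w)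
     (fun p q e => edge_spec hz L0 Ndv SP du e)).
    rewrite !bvs !bus ?mul1r ?Nl // !subr0 !addr0 /level /= !mul0r !mul1r !add0r !addr0.
    congr (_ - _ - _); apply: eq_bigr => j _.
    have -> : pole (bd j) (h j) (vs j) = 0 by rewrite /pole /bd A_vs bvs.
    have -> : pole (bd j) (h j) (us j) = 0.
      by rewrite /pole /bd A_us bus //; case: (j == iu); rewrite ?mul1r ?Nl.
    by rewrite !addr0.
  move=> j p q E' _; have := @poleE _ (bd j) (h j) _ p q E'.
  rewrite /bd /h AN => <-; first by rewrite -PhiP //; zmodule.
  by move=> w q' bw _; rewrite AD (spech_inv hz).
move: E; rewrite E1 E0 => <-; zmodule.
Qed.
End Family.

(** * Three- and four-term relations, Galois action, matrices *)

Section EdgeRelations.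
Variables (N : nat) (L : fieldType) (z : L).
Hypothesis hz : N.-primitive_root z.
Hypothesis hN : (1 < N)%N.
Variables (B : zmodType) (S : L -> L -> B).
Hypothesis SP : steinberg S.
Local Notation fd := (edge_val N z S).
Local Notation good a := (~~ (N%:Z %| a)%Z).

Let n1 : -1 != 0 :> L. Proof. by rewrite oppr_eq0 oner_neq0. Qed.

Lemma stV a w : a != 0 -> w != 0 -> S a w^-1 = - S a w.
Proof.
move=> a0 w0; apply/eqP.
by rewrite -addr_eq0 -(stMr SP) ?invr_eq0 // mulVf // (st1r SP).
Qed.

Lemma st_sub1V a w : a != 0 -> w != 0 -> 1 - w != 0 ->
  S a (1 - w^-1) = S a (-1) - S a w + S a (1 - w).
Proof.
move=> a0 w0 c0; have wi0 : w^-1 != 0 by rewrite invr_eq0.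
have -> : 1 - w^-1 = -1 * (w^-1 * (1 - w)) by field.
by rewrite !(stMr SP) ?mulf_neq0 // stV // addrA.
Qed.

Lemma st_inv_pair w : w != 0 -> 1 - w != 0 -> S (1 - w) (1 - w^-1) = 0.
Proof.
move=> w0 c0; rewrite st_sub1V // (st_diag SP c0) (st_anti SP c0 w0) (st_sub1 SP) //.
by rewrite oppr0 subr0 -mulr2n (stN1sq SP).
Qed.

(** Comes from [stD] for (1 - y) + y (1 - x) = 1 - x y, after [st_sub1V] has removed the
    inverses. *)
Lemma st_three x y : x != 0 -> y != 0 -> 1 - x != 0 -> 1 - y != 0 -> 1 - x * y != 0 ->
  S (1 - y) (1 - x^-1) = S (1 - x * y) (1 - x^-1) + S (1 - y) (1 - (x * y)^-1).
Proof.
move=> x0 y0 cx cy cxy; have xy0 : x * y != 0 by rewrite mulf_neq0.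
have E : (1 - y) + y * (1 - x) = 1 - x * y by ring.
have := stD SP cy (mulf_neq0 y0 cx); rewrite E => /(_ cxy).
rewrite !(stMr SP) // (st_diag SP cxy) (st_anti SP cy y0) (st_sub1 SP y0 cy) oppr0 => H.
have H2 : S (1 - x * y) x + S (1 - x * y) y = 0.
  by rewrite -(stMr SP) // (st_anti SP cxy xy0) (st_sub1 SP) ?oppr0.
have H3 := stN1sq SP cxy.
have H4 : S (1 - y) y = 0 by rewrite (st_anti SP cy y0) (st_sub1 SP) ?oppr0.
rewrite !st_sub1V // (stMr SP) // H4.
apply: subr0_eq.
transitivity (0 + S (1 - y) (1 - x) - S (1 - y) (1 - x * y)
    - (S (1 - x * y) y + S (1 - x * y) (1 - x)) + S (1 - x * y) (-1)
    - S (1 - x * y) (-1) *+ 2 + (S (1 - x * y) x + S (1 - x * y) y)); first zmodule.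
by rewrite H H2 H3 subr0 addr0.
Qed.

Lemma good_det u v : det2 u v = 1 -> good u.2 || good v.2.
Proof.
move=> E; rewrite -negb_and; apply/negP => /andP[Ha Hb].
have : (N%:Z %| det2 u v)%Z by rewrite /det2 rpredB // dvdz_mull.
by rewrite E dvdz1; lia.
Qed.

(** The case N | a + b fixes the convention of [edge_val]: there z^(-a) = z^b, and {1 - z^b, 1 -
    z^b} = {1 - z^b, -1}. When N divides a or b, one term is {1 - w, 1 - w^-1} = 0. *)
Lemma edge_val_three a b : good a || good b -> fd a b = fd a (a + b) + fd (a + b) b.
Proof.
have z0 := z_neq0 hz; have zX c := zX_neq0 hz c; have ze c := invr_expz z c.
have [Ha|Ha] := boolP (N%:Z %| a)%Z.
  move=> /= gb; have gab : good (a + b) by rewrite rpredDl.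
  rewrite /edge_val (negPf gb) (negPf gab) Ha.
  have -> : z ^ (a + b) = z ^ b by apply: (zX_mod hz); rewrite addrK.
  have -> : z ^ (- (a + b)) = (z ^ b)^-1.
    by rewrite ze; apply: (zX_mod hz); rewrite opprD addrK rpredN.
  by rewrite st_inv_pair ?addr0 // (sub1zX_neq0 hz).
have [Hb|Hb] := boolP (N%:Z %| b)%Z => _.
  have gab : good (a + b) by rewrite rpredDr.
  rewrite /edge_val Hb (negPf gab) (negPf Ha) addr0.
  have -> : z ^ (a + b) = z ^ a by apply: (zX_mod hz); have -> : a + b - a = b by ring.
  by rewrite -ze st_inv_pair // (sub1zX_neq0 hz).
have ca := sub1zX_neq0 hz Ha; have cb := sub1zX_neq0 hz Hb.
have [Hab|Hab] := boolP (N%:Z %| a + b)%Z.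
  rewrite /edge_val Hab (negPf Ha) (negPf Hb) add0r.
  have -> : z ^ (- a) = z ^ b by apply: (zX_mod hz); rewrite -opprD rpredN.
  by rewrite (st_diag SP).
have cab := sub1zX_neq0 hz Hab.
rewrite /edge_val (negPf Ha) (negPf Hb) (negPf Hab).
rewrite -!ze expfzDr // in cab *.
by rewrite (st_three (x := z ^ a)).
Qed.
End EdgeRelations.

(** * Symbols of roots of unity and the Galois action on K_2(L)/Z_N *)

Section Action.
Variables (N : nat) (L : fieldType) (z : L).
Hypothesis hz : N.-primitive_root z.
Hypothesis hN : (1 < N)%N.
Local Notation M := (K2Z z).
Local Notation S := (@sy L z).
Local Notation fd := (edge_val N z S).
Local Notation good a := (~~ (N%:Z %| a)%Z).
Let SP := sy_steinberg z.
Let n1 : -1 != 0 :> L. Proof. by rewrite oppr_eq0 oner_neq0. Qed.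

Lemma even_mulrz (x : M) (n : int) : x *+ 2 = 0 -> (2 %| n)%Z -> x *~ n = 0.
Proof. by move=> x2 /dvdzP[k ->]; rewrite mulrC mulrzA -pmulrn x2 mul0rz. Qed.

(** Killing {-1, -z} identifies {-1, z} with the 2-torsion element e = {-1, -1}, so the symbol is e
    times 1 + b - a + a b, which is even when a or b is odd. For N odd, N {-1, z} = 0 forces e =
    0. *)
Lemma sy_roots (a b : int) : odd N \/ odd `|a| \/ odd `|b| ->
  S (- z ^ a) (- z ^ b) = 0.
Proof.
move=> H; have z0 := z_neq0 hz; have zX c := zX_neq0 hz c.
set e := S (-1) (-1); have e2 : e *+ 2 = 0 by apply: (stN1sq SP).
have Nz : S (-1) z = e.
  have := sy_root z; rewrite -[- z]mulN1r (stMr SP) // -/e => /eqP.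
  by rewrite addrC addr_eq0 => /eqP ->; apply/eqP; rewrite -subr_eq0 -opprD oppr_eq0 -mulr2n e2.
have zN : S z (-1) = e.
  by rewrite (st_anti SP) // Nz; apply/eqP; rewrite -subr_eq0 -opprD oppr_eq0 -mulr2n e2.
have -> : S (- z ^ a) (- z ^ b) = e *~ (1 + b - a + a * b).
  rewrite -[- z ^ a]mulN1r -[- z ^ b]mulN1r (stMl SP) ?mulf_neq0 // !(stMr SP) //.
  rewrite [S (z ^ a) (-1)](st_anti SP) // [S (z ^ a) _](st_anti SP) // !(stXzr _ SP) //.
  rewrite [S (z ^ b) z](st_anti SP) // (stXzr _ SP) // [S z z](st_diag SP) // zN Nz -/e.
  by rewrite mulNrz opprK -mulrzA !mulrzDr mulrNz mulr1z [b * a]mulrC; zmodule.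
have parity : 1 + b - a + a * b = (1 + a) * (1 + b) - 2 * a by ring.
case: H => [oN|[oa|ob]]; last 2 first.
- apply: even_mulrz => //; rewrite parity; apply: rpredB; last exact: dvdz_mulr.
  by apply: dvdz_mulr; lia.
- apply: even_mulrz => //; rewrite parity; apply: rpredB; last exact: dvdz_mulr.
  by apply: dvdz_mull; lia.
suff -> : e = 0 by rewrite mul0rz.
have : e *+ N = 0.
  by rewrite -Nz -(stXr SP) // (prim_expr_order hz) (st1r SP).
by rewrite (order2_parity (n := 1) e2) ?oN.
Qed.

(** By 1 - z^(-c) = - z^(-c) (1 - z^c) the four terms reduce to {-z^(-a), -z^(-b)}, which [sy_roots]
    kills: determinant 1 excludes that both a and b are even. *)
Lemma edge_val_four u v : det2 u v = 1 ->
  fd u.2 v.2 + fd v.2 (- u.2) + fd (- u.2) (- v.2) + fd (- v.2) u.2 = 0.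
Proof.
move=> E; have gg := good_det hz hN E.
have odd_or : odd N \/ odd `|u.2| \/ odd `|v.2|.
  move: E; rewrite /det2 => E; case: (boolP (odd `|u.2|)) => [|eu]; first by auto.
  case: (boolP (odd `|v.2|)) => [|ev]; first by auto.
  have [k Ek] : exists k, u.2 = 2 * k by exists (u.2 %/ 2)%Z; lia.
  have [k' Ek'] : exists k', v.2 = 2 * k' by exists (v.2 %/ 2)%Z; lia.
  by exfalso; move: E; rewrite Ek Ek'; lia.
move: (u.2) (v.2) gg odd_or => a b {u v E} gg odd_or.
have z0 := z_neq0 hz; have zX c := zX_neq0 hz c.
have sub1N c : 1 - z ^ (- c) = - z ^ (- c) * (1 - z ^ c).
  by rewrite mulrBr mulr1 mulNr -expfzDr // addNr expr0z opprK addrC.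
have N0 c : - z ^ c != 0 by rewrite oppr_eq0.
have N1E : -1 = - z ^ 0 by rewrite expr0z.
have oddN c : (N%:Z %| c)%Z -> odd `|c| -> odd N by rewrite dvdzE; apply: dvdn_odd.
have S1N c : good c -> odd N \/ odd `|c| -> S (1 - z ^ c) (-1) + S (1 - z ^ (- c)) (-1) = 0.
  move=> gc oc; have c0 := sub1zX_neq0 hz gc.
  rewrite sub1N (stMl SP) // {2}N1E sy_roots; last by rewrite abszN; case: oc; auto.
  by rewrite add0r -mulr2n (stN1sq SP).
rewrite /edge_val ![(_ %| - _)%Z]rpredN.
have [Ha|Ha] := boolP (N%:Z %| a)%Z.
  move: gg; rewrite Ha /= => gb; rewrite (negPf gb) !addr0 S1N //.
  by case: odd_or => [|[/(oddN _ Ha)|]]; auto.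
have [Hb|Hb] := boolP (N%:Z %| b)%Z.
  rewrite add0r addr0 addrC S1N //.
  by case: odd_or => [|[|/(oddN _ Hb)]]; auto.
have a0 := sub1zX_neq0 hz Ha; have b0 := sub1zX_neq0 hz Hb.
have a'0 : 1 - z ^ (- a) != 0 by rewrite (sub1zX_neq0 hz) ?rpredN.
have b'0 : 1 - z ^ (- b) != 0 by rewrite (sub1zX_neq0 hz) ?rpredN.
rewrite !opprK (st_anti SP b0 a'0) (st_anti SP b'0 a0).
have -> : S (1 - z ^ (- a)) (1 - z ^ (- b)) = S (1 - z ^ (- a)) (- z ^ (- b)) + S (1 - z ^ (- a)) (1 - z ^ b).
  by rewrite -(stMr SP) // -sub1N.
have -> : S (1 - z ^ a) (1 - z ^ (- b)) = S (1 - z ^ a) (- z ^ (- b)) + S (1 - z ^ a) (1 - z ^ b).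
  by rewrite -(stMr SP) // -sub1N.
rewrite [1 - z ^ (- a)]sub1N !(stMl SP) // sy_roots; last by rewrite !abszN.
zmodule.
Qed.

Lemma act_steinberg (f : {rmorphism L -> L}) : steinberg (fun a b => S (f a) (f b)).
Proof.
split=> [a b c a0 b0 c0|a b c a0 b0 c0|a b a0 b0 c0].
- by rewrite rmorphM (stMl SP) ?fmorph_eq0.
- by rewrite rmorphM (stMr SP) ?fmorph_eq0.
- by rewrite rmorphD (stD SP) // -?rmorphD ?fmorph_eq0.
Qed.

Definition act (f : L -> L) (m : M) : M := cls z (fmap f (repr m)).

Section GaloisAction.
Variables (f : {rmorphism L -> L}) (k : nat).
Hypotheses (fz : f z = z ^+ k) (kN : coprime k N).

Lemma f_zX c : f (z ^ c) = z ^ (k%:Z * c).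
Proof. by rewrite fmorphXz fz -exprz_exp -exprnP. Qed.

Lemma cls_fmap s : cls z (fmap f s) = feval (fun a b => S (f a) (f b)) s.
Proof. by rewrite cls_feval /feval big_map. Qed.

(** Well-definedness: f must preserve Z_N, that is {-1, -z^k} = 0, and k is odd when N is even
    because it is prime to N. *)
Lemma act_cls s : act f (cls z s) = cls z (fmap f s).
Proof.
rewrite /act !cls_fmap; apply: cls_lift; last exact: cls_repr; first exact: act_steinberg.
rewrite !rmorphN rmorph1 fz -[in S (- 1)](expr0z z) exprnP sy_roots //.
have [oN|eN] := boolP (odd N); first by left.
right; right; rewrite absz_nat; apply: contraT => ek.
move: kN; rewrite /coprime => /eqP g1.
have : (2 %| gcdn k N)%N by rewrite dvdn_gcd !dvdn2 ek eN.
by rewrite g1.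
Qed.

Lemma actD : {morph act f : x y / x + y}.
Proof.
move=> x y; rewrite -[x]cls_repr -[y]cls_repr -cls_cat !act_cls -cls_cat.
by rewrite /fmap map_cat.
Qed.
Lemma act0 : act f 0 = 0.
Proof. by rewrite -(cls_nil z) act_cls. Qed.
Lemma actN x : act f (- x) = - act f x.
Proof. by apply/eqP; rewrite -addr_eq0 -actD addNr act0. Qed.
Lemma actB x y : act f (x - y) = act f x - act f y.
Proof. by rewrite actD actN. Qed.
Lemma actMz x n : act f (x *~ n) = act f x *~ n.
Proof.
have P m : act f (x *+ m) = act f x *+ m.
  by elim: m => [|m IH]; rewrite ?mulr0n ?act0 // !mulrS actD IH.
by case: n => m; [exact: P|rewrite NegzE !mulrNz actN -!pmulrn P].
Qed.
Lemma act_sum (I : Type) (r : seq I) (F : I -> M) :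
  act f (\sum_(i <- r) F i) = \sum_(i <- r) act f (F i).
Proof. by apply: big_morph; [exact: actD|exact: act0]. Qed.
Lemma act_sy a b : act f (S a b) = S (f a) (f b).
Proof. by rewrite act_cls. Qed.

Lemma act_edge_val a b : act f (fd a b) = fd (k%:Z * a) (k%:Z * b).
Proof.
have kd c : (N%:Z %| k%:Z * c)%Z = (N%:Z %| c)%Z.
  by rewrite Gauss_dvdzr // coprimez_sym coprimezE.
rewrite /edge_val !kd; case: ifP => _; first exact: act0.
case: ifP => _; rewrite act_sy !rmorphB !rmorph1 !f_zX ?rmorph0 ?mulrN //.
by rewrite rmorphN1.
Qed.
End GaloisAction.

Lemma act_comp (f g f' g' : {rmorphism L -> L}) k l k' l' m :
  f z = z ^+ k -> coprime k N -> g z = z ^+ l -> coprime l N ->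
  f' z = z ^+ k' -> coprime k' N -> g' z = z ^+ l' -> coprime l' N ->
  (forall a, f (g a) = f' (g' a)) -> act f (act g m) = act f' (act g' m).
Proof.
move=> fz kN gz lN fz' kN' gz' lN' E; rewrite -[m]cls_repr.
rewrite (act_cls gz) // (act_cls fz) // (act_cls gz') // (act_cls fz') //.
by rewrite /fmap -!map_comp; congr cls; apply: eq_map => t /=; rewrite !E.
Qed.
End Action.

Definition gv (g : 'M[int]_2) (w : vec) : vec :=
  (mA g * w.1 + mB g * w.2, mC g * w.1 + mD g * w.2).

Lemma sum_ord2 (F : 'I_2 -> int) : \sum_i F i = F ord0 + F ord_max.
Proof.
rewrite !big_ord_recl big_ord0 addr0; congr (_ + F _); exact: val_inj.
Qed.
Lemma gvM g h w : gv (g *m h) w = gv g (gv h w).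
Proof. by apply: vec_eq; rewrite /gv /mA /mB /mC /mD !mxE !sum_ord2 /=; ring. Qed.
Lemma det22 (g : 'M[int]_2) : \det g = mA g * mD g - mB g * mC g.
Proof.
rewrite (expand_det_row _ ord0) sum_ord2 /cofactor !det_mx11 !mxE /=.
rewrite expr0 expr1 mul1r mulN1r mulrN /mA /mB /mC /mD.
by congr (_ * g _ _ - _ * g _ _); apply: val_inj.
Qed.
Lemma det2_gv g p q : det2 (gv g p) (gv g q) = \det g * det2 p q.
Proof. by rewrite det22 /det2 /gv /=; ring. Qed.
Lemma gvD g p q : gv g (p + q) = gv g p + gv g q.
Proof. by apply: vec_eq; rewrite /gv !vE /=; ring. Qed.
Lemma gvN g p : gv g (- p) = - gv g p.
Proof. by apply: vec_eq; rewrite /gv !vE /=; ring. Qed.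
Lemma gvZ g k p : gv g (vscale k p) = vscale k (gv g p).
Proof. by apply: vec_eq; rewrite /gv !vE /=; ring. Qed.

(** * Hecke operators *)

(** [star g north] is det(g) (b, d), the vector at which the sequences defining Theta_N end; they
    start at [north]. *)
Definition star (g : 'M[int]_2) (w : vec) : vec := vscale (\det g) (gv g w).
Definition north : vec := (0, 1).

Lemma prim_scale a b v w : prim v -> prim w -> 0 < a -> 0 < b ->
  vscale a v = vscale b w -> v = w.
Proof.
move=> pv pw a0 b0 E.
have ab : (a %| b)%Z.
  have := det2_nbout pw => /(congr1 (fun t => b * t)); rewrite -det2Zl -E det2Zl mulr1 => <-.
  exact: dvdz_mulr.
have ba : (b %| a)%Z.
  have := det2_nbout pv => /(congr1 (fun t => a * t)); rewrite -det2Zl E det2Zl mulr1 => <-.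
  exact: dvdz_mulr.
have Eab : a = b.
  have [k Ek] := dvdzP ab; have [k' Ek'] := dvdzP ba.
  have k0 : 0 < k by nia.
  have k'0 : 0 < k' by nia.
  have : k * k' = 1 by apply: (@mulIf _ a); rewrite ?gt_eqF // mul1r {2}Ek' Ek; ring.
  by move=> /intM1[[k1 _]|]; [rewrite Ek k1 mul1r|lia].
move: E => [E1 E2]; have an0 : a != 0 by rewrite gt_eqF.
by apply: vec_eq; apply: (mulfI an0); rewrite ?E1 ?E2 Eab.
Qed.

(** * The l + 1 sublattices of index l *)

Section Lattices.
Variable l : nat.
Hypothesis l_prime : prime l.
Let l_gt0 : 0 < l%:Z. Proof. by have := prime_gt0 l_prime; lia. Qed.
Let l_neq0 : l%:Z != 0. Proof. by rewrite gt_eqF. Qed.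

Lemma gmatE j : [/\ mA (gmat l j) = if (j < l)%N then l%:Z else 1,
  mB (gmat l j) = if (j < l)%N then j%:Z else 0, mC (gmat l j) = 0 &
  mD (gmat l j) = if (j < l)%N then 1 else l%:Z].
Proof. by rewrite /gmat /mA /mB /mC /mD; case: ifP => _; rewrite !mxE. Qed.

Lemma det_gmat j : \det (gmat l j) = l%:Z.
Proof.
by rewrite det22; have [-> -> -> ->] := gmatE j; case: ifP => _; ring.
Qed.
Lemma gv_gmat j w : gv (gmat l j) w =
  if (j < l)%N then (l%:Z * w.1 + j%:Z * w.2, w.2) else (w.1, l%:Z * w.2).
Proof.
by rewrite /gv; have [-> -> -> ->] := gmatE j; case: ifP => _; apply: vec_eq => /=; ring.
Qed.

Definition in_lat (j : 'I_l.+1) (v : vec) : bool :=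
  if (j < l)%N then (l%:Z %| v.1 - j%:Z * v.2)%Z else (l%:Z %| v.2)%Z.
Definition lat_mult j v : int := if in_lat j v then 1 else l%:Z.

(* The coordinates, in the lattice gmat l j Z^2, of its primitive vector on the ray of v. *)
Definition lat_vec (j : 'I_l.+1) (v : vec) : vec :=
  if (j < l)%N then
    if in_lat j v then (((v.1 - j%:Z * v.2) %/ l%:Z)%Z, v.2) else (v.1 - j%:Z * v.2, l%:Z * v.2)
  else if in_lat j v then (v.1, (v.2 %/ l%:Z)%Z) else (l%:Z * v.1, v.2).

Lemma lat_mult_gt0 j v : 0 < lat_mult j v.
Proof. by rewrite /lat_mult; case: ifP. Qed.

Lemma gv_lat_vec j v : gv (gmat l j) (lat_vec j v) = vscale (lat_mult j v) v.
Proof.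
rewrite gv_gmat /lat_vec /lat_mult /in_lat; have [jl|jl] := ltnP j l; case: ifP => H; apply: vec_eq => /=.
- by rewrite mulrC divzK // mul1r subrK.
- by rewrite mul1r.
- by ring.
- by [].
- by rewrite mul1r.
- by rewrite mulrC divzK // mul1r.
- by [].
- by [].
Qed.

Lemma lat_vec_prim j v : prim v -> prim (lat_vec j v).
Proof.
have copl x : ~~ (l%:Z %| x)%Z -> coprimez x l%:Z.
  by rewrite dvdzE coprimezE coprime_sym prime_coprime.
move=> pv; have pj : coprimez (v.1 - j%:Z * v.2) v.2.
  move: pv => /coprimezP[[a b] /= E]; apply/coprimezP; exists (a, b + a * j%:Z) => /=.
  by rewrite -E; ring.
rewrite /lat_vec /in_lat /prim; have [jl|jl] := ltnP j l; case: ifP => /= H.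
- by move: pj; rewrite -[X in coprimez X](divzK H) coprimezMl => /andP[].
- by rewrite coprimezMr pj andbT copl // H.
- by move: pv; rewrite /prim -[X in coprimez _ X](divzK H) coprimezMr => /andP[].
- by rewrite coprimezMl [X in _ && X]pv andbT coprimez_sym copl // H.
Qed.

Lemma lat_vec_uniq j v w m : prim v -> prim w -> 0 < m ->
  gv (gmat l j) w = vscale m v -> w = lat_vec j v.
Proof.
move=> pv pw m0 E; apply: (prim_scale pw (lat_vec_prim j pv) (lat_mult_gt0 j v) m0).
have : gv (gmat l j) (vscale (lat_mult j v) w) = gv (gmat l j) (vscale m (lat_vec j v)).
  by rewrite !gvZ E gv_lat_vec; apply: vec_eq; rewrite !vE; ring.
rewrite !gv_gmat; have [jl|jl] := ltnP j l => -[] /= E1 E2; apply: vec_eq => //=.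
- by apply: (mulfI l_neq0); apply: (addIr (j%:Z * (lat_mult j v * w.2))); rewrite E1 E2.
- exact: (mulfI l_neq0).
Qed.

Lemma in_lat_gv j w : in_lat j (gv (gmat l j) w).
Proof.
rewrite gv_gmat /in_lat; have [jl|jl] := ltnP j l; rewrite /= ?addrK; exact: dvdz_mulr.
Qed.
Lemma in_lat_shift j v w : in_lat j v -> in_lat j (v + vscale l%:Z w).
Proof.
rewrite /in_lat; case: ifP => jl; rewrite !vE => H.
  have -> : v.1 + l%:Z * w.1 - j%:Z * (v.2 + l%:Z * w.2) =
    (v.1 - j%:Z * v.2) + l%:Z * (w.1 - j%:Z * w.2) by ring.
  by rewrite rpredD // dvdz_mulr.
by rewrite rpredD // dvdz_mulr.
Qed.

(** The sublattices contain l Z^2 and correspond to the l + 1 lines of F_l^2; a vector nonzero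
    modulo l lies on exactly one line, whose index is v.1 / v.2 modulo l, or [ord_max] if l |
    v.2. *)
Lemma in_lat_unique v : ~~ ((l%:Z %| v.1)%Z && (l%:Z %| v.2)%Z) ->
  exists i, forall j, in_lat j v = (j == i).
Proof.
move=> nd; have [d2|nd2] := boolP (l%:Z %| v.2)%Z.
  exists ord_max => j; rewrite /in_lat d2; rewrite d2 andbT in nd.
  have [jl|jl] := ltnP j l.
    by rewrite -val_eqE /= ltn_eqF // rpredBr ?dvdz_mull // (negPf nd).
  by apply/esym/eqP/val_inj; apply/eqP; rewrite /= eqn_leq jl -ltnS ltn_ord.
have : coprimez v.2 l%:Z by move: nd2; rewrite dvdzE coprimezE coprime_sym prime_coprime.
case/coprimezP=> [[a c] /= E].
have r0 := modz_ge0 (a * v.1) l_neq0; have rl := ltz_pmod (a * v.1) l_gt0.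
have rd := divz_eq (a * v.1) l%:Z.
set r := (a * v.1 %% l%:Z)%Z in r0 rl rd.
have rlt : (absz r < l.+1)%N by lia.
have Er : (absz r)%:Z = r by lia.
have dr : (l%:Z %| v.1 - r * v.2)%Z.
  have -> : v.1 - r * v.2 = l%:Z * (v.1 * c + (a * v.1 %/ l%:Z)%Z * v.2).
    transitivity (v.1 * (a * v.2 + c * l%:Z) - r * v.2); first by rewrite E mulr1.
    have -> : r = a * v.1 - (a * v.1 %/ l%:Z)%Z * l%:Z by rewrite {1}rd; ring.
    by ring.
  exact: dvdz_mulr.
exists (Ordinal rlt) => j; rewrite /in_lat; have [jl|jl] := ltnP j l; last first.
  rewrite (negPf nd2); apply/esym/eqP => /(congr1 val) /= jr; move: jl rl; rewrite jr; lia.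
apply/idP/eqP => [dj|->]; last by rewrite /= Er.
have : (l%:Z %| (r - j%:Z) * v.2)%Z.
  have -> : (r - j%:Z) * v.2 = (v.1 - j%:Z * v.2) - (v.1 - r * v.2) by ring.
  exact: rpredB.
rewrite Gauss_dvdzl; last by move: nd2; rewrite dvdzE coprimezE prime_coprime.
move=> /dvdzP[k Ek]; apply: val_inj => /=.
have k1 : k < 1 by rewrite -(ltr_pM2r l_gt0) mul1r -Ek; move: rl r0 jl; lia.
have k2 : -1 < k by rewrite -(ltr_pM2r l_gt0) mulN1r -Ek; move: rl r0 jl; lia.
have k0 : k = 0 by lia.
move: Ek; rewrite k0 mul0r => /eqP; rewrite subr_eq0 => /eqP rj.
by move: Er; rewrite {2}rj => -[->].
Qed.
End Lattices.

Section Hecke.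
Variables (N : nat) (L : fieldType) (z : L).
Hypothesis hz : N.-primitive_root z.
Hypothesis hN : (1 < N)%N.
Hypothesis L0 : forall n, n.+1%:R != 0 :> L.
Variable sigma : nat -> {rmorphism L -> L}.
Hypothesis hsigma : forall j : nat, coprime j N -> sigma j z = z ^+ j.
Hypothesis rmorph_ext : forall f g : {rmorphism L -> L}, f z = g z -> f =1 g.
Local Notation M := (K2Z z).
Local Notation S := (@sy L z).
Local Notation fd := (edge_val N z S).
Local Notation good a := (~~ (N%:Z %| a)%Z).
Let SP := sy_steinberg z.

Definition sgn (g : 'M[int]_2) : nat := absz (mD g %% N%:Z)%Z.
Definition gsig g : {rmorphism L -> L} := sigma (sgn g).

Lemma sgn_mod g : (N%:Z %| (sgn g)%:Z - mD g)%Z.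
Proof.
rewrite /sgn gez0_abs; last by apply: modz_ge0; lia.
by rewrite -eqz_mod_dvd modz_mod.
Qed.
Lemma sgn_coprime g : coprimez (mD g) N%:Z -> coprime (sgn g) N.
Proof.
move=> /coprimezP[[a b] /= E]; have /dvdzP[k Ek] := sgn_mod g.
rewrite -[coprime _ _]/(coprimez (sgn g)%:Z N%:Z); apply/coprimezP.
by exists (a, b - a * k) => /=; rewrite -E -[(sgn g)%:Z](subrK (mD g)) Ek; ring.
Qed.
Lemma gsig_z g : coprimez (mD g) N%:Z -> gsig g z = z ^+ sgn g.
Proof. by move=> /sgn_coprime /hsigma. Qed.
Lemma gsig_edge_val g a b : coprimez (mD g) N%:Z ->
  act (gsig g) (fd a b) = fd (mD g * a) (mD g * b).
Proof.
move=> c; rewrite (act_edge_val hz hN (gsig_z c) (sgn_coprime c)); apply: (edge_val_mod hz);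
  by rewrite -mulrBl dvdz_mulr // sgn_mod.
Qed.

Lemma G0t_coprime g : in_G0t N g -> coprimez (mD g) N%:Z.
Proof.
move=> [/dvdzP[k Ek] dg]; apply/coprimezP; rewrite det22 Ek in dg.
case: dg => E; [exists (mA g, - (mB g * k))|exists (- mA g, mB g * k)]; rewrite /= -[RHS]opprK.
  by rewrite -[X in - - X]E; ring.
by rewrite -E; ring.
Qed.
Lemma gmat_coprime l j : coprime l N -> coprimez (mD (gmat l j)) N%:Z.
Proof. by move=> lN; have [_ _ _ ->] := gmatE j; case: ifP; rewrite ?coprimezE ?coprime1n. Qed.

Lemma good_mul k a : coprimez k N%:Z -> good (k * a) = good a.
Proof. by move=> c; rewrite Gauss_dvdzr // coprimez_sym. Qed.

Variable F : vec -> M.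
Hypothesis FP : forall u v, det2 u v = 1 -> F v - F u = fd u.2 v.2.
Hypothesis F_north : F north = 0.

(** Orientation reversal: antisymmetry if N divides neither a nor b, and otherwise an error attached
    to the bad end. *)
Lemma edge_val_rev a b : good a || good b ->
  - fd (- b) (- a) = fd a b + ((if (N%:Z %| b)%Z then S (1 - z ^ (- a)) (-1) else 0)
                              - (if (N%:Z %| a)%Z then S (1 - z ^ b) (-1) else 0)).
Proof.
rewrite /edge_val ![(_ %| - _)%Z]rpredN !opprK.
have [Ha|Ha] := boolP (N%:Z %| a)%Z; have [Hb|Hb] := boolP (N%:Z %| b)%Z => //= _.
- by rewrite oppr0 add0r subrr.
- have := stN1sq SP (sub1zX_neq0 (a := - a) hz _); rewrite rpredN => /(_ Ha) E2.
  by rewrite add0r subr0; apply/eqP; rewrite -subr_eq0 -opprD -mulr2n E2 oppr0.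
rewrite subr0 addr0 (st_anti SP) ?opprK // (sub1zX_neq0 hz) // rpredN //.
Qed.

(** Follows from uniqueness of potentials. For determinant -1, [star g] reverses oriented bases, and
    the correction [pole bd h] vanishes at end points whose height N does not divide. *)
Lemma F_star g p q : in_G0t N g -> prim p -> prim q -> good p.2 -> good q.2 ->
  F (star g q) - F (star g p) = act (gsig g) (F q - F p).
Proof.
move=> Gg pp pq gp gq; have c := G0t_coprime Gg; have [Nc dg] := Gg.
have fz := gsig_z c; have fc := sgn_coprime c.
have level2 w : (N%:Z %| (gv g w).2 - mD g * w.2)%Z by rewrite /gv /= addrK dvdz_mulr.
rewrite (actB hz hN fz fc).
case: dg => dg.
  apply: (@potential_unique _ (fun w => F (star g w)) (fun w => act (gsig g) (F w))) => // u v E.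
  rewrite -(actB hz hN fz fc) !FP ?gsig_edge_val //; last by rewrite /star dg !det2E det2_gv dg E !mul1r.
  by apply: (edge_val_mod hz); rewrite /star dg !vE mul1r.
pose bd (w : vec) := (N%:Z %| w.2)%Z.
pose h (w q : vec) : M := S (1 - z ^ (mD g * q.2)) (-1).
have h_inv w q' : bd w -> det2 w q' = 1 -> h w q' = h w (q' + w).
  move=> bw _; rewrite /h; congr (S (1 - _) _); apply: (zX_mod hz).
  by rewrite vE -mulrBr opprD addrA subrr add0r mulrN rpredN dvdz_mull.
have P w : good w.2 -> pole bd h w = 0 by move=> gw; rewrite /pole /bd (negPf gw).
rewrite -[F (star g q)](subr0) -{1}(P q gq) -[F (star g p)](subr0) -{1}(P p gp).
apply: (@potential_unique _ (fun w => F (star g w) - pole bd h w)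
          (fun w => act (gsig g) (F w))) => // u v E.
rewrite -(actB hz hN fz fc) FP // gsig_edge_val //.
have E' : det2 (star g v) (star g u) = 1.
  by rewrite /star dg !det2E det2_gv dg det2C E; ring.
have H1 := FP E'.
have H2 : fd (star g v).2 (star g u).2 = fd (- (mD g * v.2)) (- (mD g * u.2)).
  by apply: (edge_val_mod hz); rewrite /star dg !vE mulN1r opprK addrC -opprB rpredN level2.
have H3 := @edge_val_rev (mD g * u.2) (mD g * v.2); rewrite !good_mul // in H3.
have {H3} H3 := H3 (good_det hz hN E).
have H4 := poleE h_inv E.
have gd a : (N%:Z %| mD g * a)%Z = (N%:Z %| a)%Z by rewrite Gauss_dvdzr // coprimez_sym.
rewrite -H2 -H1 !gd in H3.
have {H4}H4 : pole bd h v - pole bd h u =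
  (if (N%:Z %| v.2)%Z then S (1 - z ^ (- (mD g * u.2))) (-1) else 0) -
  (if (N%:Z %| u.2)%Z then S (1 - z ^ (mD g * v.2)) (-1) else 0).
  by rewrite H4 /h /bd !vE mulrN.
rewrite -H4 in H3.
by transitivity (- (F (star g u) - F (star g v)) - (pole bd h v - pole bd h u));
   [zmodule|rewrite H3; zmodule].
Qed.

Section Prime.
Variable l : nat.
Hypotheses (l_prime : prime l) (lN : coprime l N).

Definition hecke_pot (v : vec) : M := \sum_(j < l.+1) act (gsig (gmat l j)) (F (lat_vec j v)).

Lemma hecke_pot_step u v : det2 u v = 1 -> good u.2 -> good v.2 ->
  hecke_pot v - hecke_pot u = fd u.2 v.2 *+ l + act (sigma l) (fd u.2 v.2)
    + (S (1 - z ^ (l%:Z * v.2)) (-1) - S (1 - z ^ v.2) (-1)) *+ l.-1.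
Proof.
move=> E gu gv_; have [pu pv] := det2_prim E.
have ndiv w : prim w -> ~~ ((l%:Z %| w.1)%Z && (l%:Z %| w.2)%Z).
  move=> /det2_nbout E'; apply/negP => /andP[d1 d2].
  have : (l%:Z %| det2 w (nbout w))%Z by apply: rpredB; [apply: dvdz_mulr|apply: dvdz_mull].
  by rewrite E' dvdz1; have := prime_gt1 l_prime; lia.
have [iu Hiu] := in_lat_unique l_prime (ndiv u pu).
have [iv Hiv] := in_lat_unique l_prime (ndiv v pv).
(* Coordinates of [gv (gmat l j) w] in the basis (u, v). *)
pose A (j : 'I_l.+1) (w : vec) : vec := (det2 (gv (gmat l j) w) v, det2 u (gv (gmat l j) w)).
have AD j p q : A j (p + q) = A j p + A j q by rewrite /A gvD !det2E.
have AN j p : A j (- p) = - A j p by rewrite /A gvN !det2E.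
have Adet j p q : det2 (A j p) (A j q) = l%:Z * det2 p q.
  rewrite -(det_gmat j) -det2_gv -[RHS]mulr1 -E /A /det2 /=; ring.
have Au j : A j (lat_vec j u) = (if j == iu then 1 else l%:Z, 0).
  by rewrite /A gv_lat_vec !det2E E mulr1 mulr0 /lat_mult Hiu.
have Av j : A j (lat_vec j v) = (0, if j == iv then 1 else l%:Z).
  by rewrite /A gv_lat_vec !det2E E mulr1 mulr0 /lat_mult Hiv.
have decomp P : P = vscale (det2 P v) u + vscale (det2 u P) v.
  by apply: vec_eq; rewrite !vE -[LHS]mulr1 -E /det2; ring.
(* The images P and Q are congruent modulo l and nonzero modulo l, so they lie in one and the same
   sublattice. *)
have Ainj i j p q : (A i p).2 = 1 -> (A j q).2 = 1 ->
    (l%:Z %| (A i p).1 - (A j q).1)%Z -> i = j.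
  rewrite /A /=; set P := gv _ p; set Q := gv _ q => EP EQ /dvdzP[k Ek].
  have ndP : ~~ ((l%:Z %| P.1)%Z && (l%:Z %| P.2)%Z).
    apply/negP => /andP[d1 d2]; have : (l%:Z %| det2 u P)%Z.
      by apply: rpredB; [apply: dvdz_mull|apply: dvdz_mulr].
    by rewrite EP dvdz1; have := prime_gt1 l_prime; lia.
  have [i0 Hi0] := in_lat_unique l_prime ndP.
  have /eqP -> : i == i0 by rewrite -Hi0 in_lat_gv.
  apply/eqP; rewrite eq_sym -Hi0.
  have -> : P = Q + vscale l%:Z (vscale k u).
    rewrite (decomp P) (decomp Q) EP EQ -[det2 P v](subrK (det2 Q v)) Ek.
    by apply: vec_eq; rewrite !vE; ring.
  by apply: in_lat_shift; exact: in_lat_gv.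
have PhiP j p q : det2 p q = 1 ->
    act (gsig (gmat l j)) (F q) - act (gsig (gmat l j)) (F p) =
    fd (level v.2 u.2 (A j p)) (level v.2 u.2 (A j q)).
  have c := gmat_coprime j lN.
  move=> Epq; rewrite -(actB hz hN (gsig_z c) (sgn_coprime c)) FP // gsig_edge_val //.
  have lev w : level v.2 u.2 (A j w) = mD (gmat l j) * w.2.
    have -> : level v.2 u.2 (A j w) = (gv (gmat l j) w).2.
      by rewrite [in RHS](decomp (gv (gmat l j) w)) /level /A !vE.
    by rewrite /gv /=; have [_ _ -> _] := gmatE j; rewrite mul0r add0r.
  by rewrite !lev.
have := @family_identity N L z hz L0 u.2 v.2 gu gv_ l l_prime lN A _ _ iu iv AD AN Adet
  (fun j => lat_vec_prim l_prime j pu) (fun j => lat_vec_prim l_prime j pv) Au Av Ainj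
  _ _ SP (fun j w => act (gsig (gmat l j)) (F w)) PhiP.
rewrite /hecke_pot -sumrB => ->.
by rewrite (act_edge_val hz hN (hsigma lN) lN).
Qed.

(** [star (gam j)] takes the primitive vector of sublattice j on the ray of [north] to that of
    sublattice pi j on the ray of [star g north]. [F_star] for gam j, between [north] and that
    vector, then splits each summand. *)
Lemma hecke_pot_star g (pi : {perm 'I_l.+1}) (gam : 'I_l.+1 -> 'M[int]_2) :
  in_G0t N g ->
  (forall j, g *m gmat l j = gmat l (pi j) *m gam j /\ in_G0t N (gam j)) ->
  \sum_j act (gsig (gmat l (pi j))) (F (star (gam j) north)) =
  hecke_pot (star g north) - act (gsig g) (hecke_pot north).
Proof.
move=> Gg Hgam; have cg := G0t_coprime Gg.
have pn : prim north by rewrite /prim /north /coprimez /= gcd0z.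
have gn : good north.2 by rewrite /north /= dvdz1; lia.
have det_unit h : in_G0t N h -> \det h * \det h = 1 by case=> _ [->|->].
have star_prim h w : in_G0t N h -> prim w -> prim (star h w).
  move=> Gh pw; have : det2 (star h w) (gv h (nbout w)) = 1.
    by rewrite /star det2Zl det2_gv det2_nbout // mulr1 det_unit.
  by move/det2_prim => [].
have lat_good (j : 'I_l.+1) : good (lat_vec j north).2.
  rewrite /lat_vec; have [jl|jl] := ltnP j l; have [H|H] := boolP (in_lat j north) => //=.
    by rewrite good_mul // coprimezE.
  by move: H; rewrite /in_lat ltnNge jl /= dvdz1; have := prime_gt1 l_prime; lia.
have termE j : act (gsig (gmat l (pi j))) (F (star (gam j) north)) =
    act (gsig (gmat l (pi j))) (F (lat_vec (pi j) (star g north)))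
    - act (gsig g) (act (gsig (gmat l j)) (F (lat_vec j north))).
  have [Ej Gj] := Hgam j; have cj := G0t_coprime Gj.
  have cp := gmat_coprime (pi j) lN; have c' := gmat_coprime j lN.
  have dE : \det (gam j) = \det g.
    have := congr1 determinant Ej; rewrite !det_mulmx !det_gmat mulrC => /mulfI -> //.
    by have := prime_gt0 l_prime; lia.
  have <- : star (gam j) (lat_vec j north) = lat_vec (pi j) (star g north).
    apply: (@lat_vec_uniq l l_prime (pi j) (star g north) _ (lat_mult j north)) => //.
    - exact: star_prim.
    - by apply: star_prim => //; apply: lat_vec_prim.
    - exact: lat_mult_gt0.
    rewrite /star gvZ -gvM -Ej gvM gv_lat_vec gvZ dE.
    by apply: vec_eq; rewrite !vE; ring.
  have := F_star Gj (lat_vec_prim l_prime j pn) pn (lat_good j) gn.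
  rewrite F_north sub0r (actN hz hN (gsig_z cj) (sgn_coprime cj)) => H.
  rewrite -[F (star (gam j) north)](subrK (F (star (gam j) (lat_vec j north)))) H.
  rewrite (actD hz hN (gsig_z cp) (sgn_coprime cp)) (actN hz hN (gsig_z cp) (sgn_coprime cp)) addrC.
  congr (_ - _).
  have := @act_comp _ _ _ hz hN _ _ _ _ _ _ _ _ (F (lat_vec j north)) (gsig_z cp) (sgn_coprime cp)
    (gsig_z cj) (sgn_coprime cj) (gsig_z cg) (sgn_coprime cg) (gsig_z c') (sgn_coprime c').
  apply.
  (* Both composites are given on z by products of lower right entries, which agree modulo N because
     N divides the lower left entry of g. *)
  apply: (@rmorph_ext (gsig (gmat l (pi j)) \o gsig (gam j)) (gsig g \o gsig (gmat l j))) => /=.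
  rewrite !gsig_z // !rmorphXn !gsig_z // -!exprM !exprnP; apply: (zX_mod hz).
  have m h : (sgn h)%:Z = mD h + ((sgn h)%:Z - mD h) by rewrite addrC subrK.
  have DM (h h' : 'M[int]_2) : mD (h *m h') = mC h * mB h' + mD h * mD h'.
    by rewrite /mD /mC /mB !mxE sum_ord2.
  have D1 : (N%:Z %| mD (gam j) * mD (gmat l (pi j)) - mD (gmat l j) * mD g)%Z.
    have := congr1 mD Ej; rewrite !DM.
    have [_ _ -> _] := gmatE (pi j); rewrite mul0r add0r => Em.
    rewrite [mD (gam j) * _]mulrC -Em [mD g * _]mulrC addrK dvdz_mulr //; by case: Gg.
  rewrite !PoszM.
  have [[k1 E1] [k2 E2]] := (dvdzP (sgn_mod (gam j)), dvdzP (sgn_mod (gmat l (pi j)))).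
  have [[k3 E3] [k4 E4]] := (dvdzP (sgn_mod (gmat l j)), dvdzP (sgn_mod g)).
  rewrite (m (gam j)) (m (gmat l (pi j))) (m (gmat l j)) (m g) E1 E2 E3 E4.
  set a := mD (gam j) in D1 *; set b := mD (gmat l (pi j)) in D1 *.
  set c := mD (gmat l j) in D1 *; set d := mD g in D1 *.
  have -> : (b + k2 * N%:Z) * (a + k1 * N%:Z) - (d + k4 * N%:Z) * (c + k3 * N%:Z) =
    (a * b - c * d) + (a * k2 + k1 * b + k1 * k2 * N%:Z - c * k4 - k3 * d - k3 * k4 * N%:Z) * N%:Z by ring.
  by rewrite rpredD // dvdz_mull.
rewrite (eq_bigr _ (fun j _ => termE j)) sumrB; congr (_ - _).
  by rewrite /hecke_pot [RHS](reindex_inj (@perm_inj _ pi)).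
by rewrite /hecke_pot (act_sum hz hN (gsig_z cg) (sgn_coprime cg)).
Qed.
End Prime.

(** Admissibility controls d_i only for i < k; the last height is det(g) d, which is prime to N. *)
Lemma theta_telescope (B : zmodType) (Phi : vec -> B) (G : int -> int -> B) g s :
  (forall u v, det2 u v = 1 -> good u.2 -> good v.2 -> Phi v - Phi u = G u.2 v.2) ->
  in_G0t N g -> theta_seq_ok N g s ->
  \sum_(i <- iota 1 (size s).-1) G (nth (0, 0) s i.-1).2 (nth (0, 0) s i).2 =
  Phi (star g north) - Phi north.
Proof.
move=> H Gg [s0 sh sl sd sN].
have Es : nth (0, 0) s (size s).-1 = star g north.
  rewrite nth_last (_ : last (0, 0) s = last (0, 1) s); last by clear -s0; case: s s0.
  by rewrite sl; apply: vec_eq; rewrite /star /gv /north /=; ring.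
have gn : good (star g north).2.
  rewrite /star /gv /north /= mulr0 add0r mulr1 mulrC good_mul; last exact: G0t_coprime.
  by case: Gg => _ [->|->]; rewrite ?rpredN dvdz1; lia.
rewrite -subn1 -/(index_iota 1 (size s)) big_add1 -Es -[north]sh.
rewrite -(telescope_sumr (fun i => Phi (nth (0, 0) s i)) (leq0n (size s).-1)).
apply: eq_big_nat => i /andP[_ lt]; have lt' : (i.+1 < size s)%N by rewrite -ltn_predRL.
rewrite -H //; [exact: sd|exact: sN|].
have [eq|ne] := eqVneq i.+1 (size s).-1; first by rewrite eq Es.
by apply: sN; rewrite -ltn_predRL ltn_neqAle ne.
Qed.
End Hecke.

Lemma char0_neq0 (L : fieldExtType rat) n : n.+1%:R != 0 :> L.
Proof. by rewrite -scaler_nat scaler_eq0 oner_eq0 orbF pnatr_eq0. Qed.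

Lemma rmorph_ext (L : fieldExtType rat) (z : L) (f g : {rmorphism L -> L}) :
  <<1%VS; z>>%VS = fullv -> f z = g z -> f =1 g.
Proof.
move=> gen E a; have : a \in <<1; z>>%VS by rewrite gen memvf.
case/Fadjoin1_polyP=> p ->; rewrite -!horner_map E -!map_poly_comp.
congr (_.[_]); apply: eq_map_poly => c /=.
by rewrite (rat_linear (rmorphB f)) (rat_linear (rmorphB g)) !rmorph1.
Qed.

(** * The coboundary and both claims *)

Section Main.
Variables (N : nat) (L : fieldExtType rat) (z : L).
Hypothesis hN : (1 < N)%N.
Hypothesis hz : N.-primitive_root z.
Hypothesis hgen : <<1%VS; z>>%VS = fullv.
Variable sigma : nat -> {rmorphism L -> L}.
Hypothesis hsigma : forall j : nat, coprime j N -> sigma j z = z ^+ j.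
Variable theta : 'M[int]_2 -> fsum L.
Hypothesis htheta : is_Theta N z theta.
Local Notation M := (K2Z z).
Local Notation S := (@sy L z).
Local Notation good a := (~~ (N%:Z %| a)%Z).

Lemma fpotential_exists : exists F : vec -> M,
  (forall u v, det2 u v = 1 -> F v - F u = edge_val N z S u.2 v.2) /\ F north = 0.
Proof.
have [|u v E|F FP] := @potential_exists M (fun u v => edge_val N z S u.2 v.2).
- move=> u v E; apply: (edge_val_three hz) => //; first exact: sy_steinberg.
  exact: (good_det hz hN E).
- exact: (edge_val_four hz hN E).
by exists (fun w => F w - F north); split=> [u v E|]; [rewrite -FP //; zmodule|rewrite subrr].
Qed.

(** The parity condition kills the 2-torsion term of [hecke_pot_step] and covers both claims: l odd
    with c = 1, and l = 2 with c = 2. *)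
Lemma hecke_eisenstein l c : prime l -> coprime l N -> ~~ odd (c * l.-1) ->
  hecke_rel N z sigma theta l c%:Z.
Proof.
move=> lp lN ev; have [F [FP F0]] := fpotential_exists.
have SP := sy_steinberg z; have ext f g := @rmorph_ext L z f g hgen.
have L0 := @char0_neq0 L; have lz := hsigma lN.
have goodS (u v : vec) : good u.2 -> good v.2 ->
    edge_val N z S u.2 v.2 = S (1 - z ^ v.2) (1 - z ^ (- u.2)).
  by move=> /negPf gu /negPf gv'; rewrite /edge_val gu gv'.
have cls_theta s : cls z (theta_sum z s) =
    \sum_(i <- iota 1 (size s).-1) S (1 - z ^ (nth (0, 0) s i).2) (1 - z ^ (- (nth (0, 0) s i.-1).2)).
  by rewrite cls_feval /feval big_map; apply: eq_bigr => i _ /=; rewrite mulr1z.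
have thetaF g : in_G0t N g -> cls z (theta g) = F (star g north).
  move=> Gg; have [s [ok ->]] := htheta Gg; rewrite cls_theta.
  pose G (a b : int) : M := S (1 - z ^ b) (1 - z ^ (- a)).
  have FG u v : det2 u v = 1 -> good u.2 -> good v.2 -> F v - F u = G u.2 v.2.
    by move=> E gu gv'; rewrite FP // goodS.
  by have := theta_telescope hz hN FG Gg ok; rewrite F0 subr0.
pose H (v : vec) : M := hecke_pot N sigma F l v.
have thetaH g : in_G0t N g -> (H (star g north) - H north) *~ c =
    (cls z (theta g) *+ l + act (sigma l) (cls z (theta g))) *~ c.
  move=> Gg; have [s [ok ->]] := htheta Gg; rewrite cls_theta.
  rewrite (act_sum hz hN lz lN) -sumrMnl -big_split /= mulrz_suml mulrzBl.
  pose G (a b : int) : M := (S (1 - z ^ b) (1 - z ^ (- a)) *+ l + act (sigma l) (S (1 - z ^ b) (1 - z ^ (- a)))) *~ c.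
  suff HG u v : det2 u v = 1 -> good u.2 -> good v.2 -> H v *~ c - H u *~ c = G u.2 v.2.
    by rewrite -(theta_telescope (Phi := fun v => H v *~ c) hz hN HG Gg ok).
  move=> E gu gv'; rewrite -mulrzBl (hecke_pot_step hz hN L0 hsigma FP lp lN E gu gv') goodS //.
  rewrite mulrzDl -[RHS]addr0; congr (_ + _); rewrite -pmulrn -mulrnA mulnC.
  have lc : coprimez l%:Z N%:Z by [].
  have E2 d : good d -> S (1 - z ^ d) (-1) *+ (c * l.-1) = 0.
    move=> gd; have e2 := stN1sq SP (sub1zX_neq0 hz gd).
    by rewrite (order2_parity (n := 0) e2) // (negPf ev).
  by rewrite mulrnBl !E2 ?subrr // Gauss_dvdzr // coprimez_sym.
(* T_l Theta takes g to H(star g north) - g H(north), while c (l + sigma_l) Theta takes it to c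
   (H(star g north) - H(north)); c times the first minus the second is g m - m for m = - c
   H(north). *)
exists (repr (- (H north *~ c))) => g Gg pi gam Hgam.
have cg := G0t_coprime Gg; have gz := gsig_z hz hN hsigma cg; have gc := sgn_coprime hz hN cg.
apply/clsP; apply/eqP; rewrite !(cls_cat, cls_scale) cls_repr mulrN1z.
have actE h t : coprimez (mD h) N%:Z -> cls z (gact N sigma h t) = act (gsig N sigma h) (cls z t).
  by move=> ch; rewrite (act_cls hz hN (gsig_z hz hN hsigma ch) (sgn_coprime hz hN ch)).
have -> : cls z (flatten [seq gact N sigma (gmat l (pi j)) (theta (gam j)) | j <- enum 'I_l.+1]) =
    \sum_j act (gsig N sigma (gmat l (pi j))) (F (star (gam j) north)).
  rewrite cls_feval feval_flatten big_enum; apply: eq_bigr => j _.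
  rewrite -cls_feval actE; last exact: gmat_coprime.
  by rewrite thetaF //; have [_] := Hgam j.
rewrite (hecke_pot_star hz hN hsigma ext FP F0 lp lN Gg Hgam) actE // cls_repr.
rewrite -(act_cls hz hN lz lN) -[cls z (theta g) *~ l%:Z]pmulrn -(thetaH g Gg).
rewrite (actN hz hN gz gc) (actMz hz hN gz gc) !mulrzBl /H.
zmodule.
Qed.
End Main.

Theorem mainTheorem11 (N : nat) (hN : (2 <= N)%N)
  (L : fieldExtType rat) (z : L)
  (hz : N.-primitive_root z) (hgen : <<1%VS; z>>%VS = fullv)
  (sigma : nat -> {rmorphism L -> L})
  (hsigma : forall j : nat, coprime j N -> sigma j z = z ^+ j)
  (theta : 'M[int]_2 -> fsum L) (htheta : is_Theta N z theta) :
  (forall l : nat, prime l -> ~~ (l %| 2 * N)%N -> hecke_rel N z sigma theta l 1)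
  /\ (odd N -> hecke_rel N z sigma theta 2 2).
Proof.
split=> [l lp|oN].
  rewrite Euclid_dvdM // negb_or => /andP[l2 lN].
  apply: (hecke_eisenstein hN hz hgen hsigma htheta lp); first by rewrite prime_coprime.
  rewrite mul1n; move: l2; rewrite dvdn_prime2 // => l2.
  by case: (even_prime lp) => [E|]; [rewrite E in l2|case: (l) (prime_gt0 lp)].
by apply: (hecke_eisenstein hN hz hgen hsigma htheta) => //; rewrite coprime2n.
Qed.
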